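(* Let $m \geq 2$ and $n \geq 3$ be integers. Every finitely generated group quasi-isometrically embeds in an $(m,n)$-generated simple group.
   Context: A group $G$ is $(m,n)$-generated if there exist $\alpha, \beta \in G$ with $\alpha$ of order $m$ and $\beta$ of order $n$ such that $G = \langle \alpha, \beta \rangle$. A finitely generated group $H$ quasi-isometrically embeds in a finitely generated group $G$ if there is an injective group homomorphism $H \to G$ that is a quasi-isometric embedding with respect to word metrics coming from finite generating sets. *)

(* Defs.v *)
From mathcomp Require Import all_boot all_order all_algebra.
From mathcomp Require Import boolp classical_sets reals.
Set Implicit Arguments.
Unset Strict Implicit.
Unset Printing Implicit Defensive.

Local Open Scope classical_set_scope.

Section Groups.
Local Open Scope group_scope.
Variable G : groupType.

Definition generated_subgroup (A : set G) : set G :=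
  smallest (fun K : set G => group_closed [in K]) A.

Definition generates (S : seq G) : Prop :=
  generated_subgroup [set` S] = [set: G].

Definition finitely_generated : Prop := exists S : seq G, generates S.

Definition has_order (g : G) (k : nat) : Prop :=
  [/\ (0 < k)%N, g ^+ k = 1 & forall j, (0 < j < k)%N -> g ^+ j <> 1].

Definition mn_generated (m n : nat) : Prop :=
  exists a b : G, [/\ has_order a m, has_order b n & generates [:: a; b]].

Definition normal_subgroup (N : set G) : Prop :=
  group_closed [in N] /\ (forall x y, N x -> N (x ^ y)).

Definition simple_group : Prop :=
  [set: G] <> [set 1] /\
  forall N, normal_subgroup N -> N = [set 1] \/ N = [set: G].

(* g is a product of k elements of S `|` S^-1. *)
Definition has_word (S : seq G) (g : G) (k : nat) : Prop :=
  exists w : seq G, [/\ all (fun x => (x \in S) || (x^-1 \in S)) w,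
                        size w = k & \prod_(x <- w) x = g].

(* Least length of a word representing g; the default value 0 is only used
   when g does not lie in the subgroup generated by S. *)
Definition word_length (S : seq G) (g : G) : nat :=
  if pselect (exists k, `[< has_word S g k >]) is left gSg
  then ex_minn gSg else 0%N.

Definition word_metric (S : seq G) (x y : G) : nat :=
  word_length S (x^-1 * y).

End Groups.

Section QuasiIsometry.
Import GRing.Theory Num.Theory.
Local Open Scope ring_scope.

Definition qi_embedding (R : realType) (X Y : Type)
    (dX : X -> X -> R) (dY : Y -> Y -> R) (f : X -> Y) : Prop :=
  exists L C : R, [/\ 1 <= L, 0 <= C & forall x y,
    L^-1 * dX x y - C <= dY (f x) (f y) <= L * dX x y + C].

(* Meant for finitely generated H and G.  Word metrics for two finite
   generating sets of the same group are bi-Lipschitz equivalent, so it makes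
   no difference whether S and T are quantified universally or existentially. *)
Definition qi_embeds (R : realType) (H G : groupType) : Prop :=
  exists f : {multiplicative H -> G}, injective f /\
    forall (S : seq H) (T : seq G), generates S -> generates T ->
      qi_embedding (fun x y => (word_metric S x y)%:R : R)
                   (fun x y => (word_metric T x y)%:R : R) f.

End QuasiIsometry.

Arguments finitely_generated : clear implicits.
Arguments mn_generated : clear implicits.
Arguments simple_group : clear implicits.

(* Main.v *)
Require Import Defs.
From HB Require Import structures.
From mathcomp Require Import all_boot all_order all_algebra.
From mathcomp Require Import boolp classical_sets reals.
From mathcomp Require Import zify.

Set Implicit Arguments.
Unset Strict Implicit.
Unset Printing Implicit Defensive.

(* Let W be the set of families of binary streams indexed by H and one more index,
   on which H acts by permuting the indices.  The group G = <alpha, beta> acts on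
   D x W for a finite set D of letters.  A brick is the image of one letter under a
   word in the maps "add a first digit to one stream" and the elements of H; the
   bricks form a basis of the topology.

   Here beta permutes letters in n-cycles and alpha permutes bricks in m-cycles.
   The cycles are arranged as in a planar map whose faces are the cycles of
   alpha beta on letters.  The labels of alpha (the generators of H and the maps
   adding a digit) join faces in pairs, without making the order of alpha beta
   infinite there.  One face has prime length N + 1, prime to the order of
   alpha beta elsewhere, so that a power of alpha beta is a cycle c of letters of
   length N + 1.  The commutator of c and beta c beta^-1 is a 3-cycle of letters.
   Conjugating it, one obtains all 3-cycles of letters, then, by means of the
   labels, all 3-cycles of disjoint bricks.

   Simplicity: a nontrivial element moves some brick off itself, so a nontrivial
   normal subgroup contains a 3-cycle of bricks, hence all of them, hence all
   transpositions of bricks, and alpha and beta are products of these.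

   Distortion: H acts on the second half of a letter.  The set of indices in H whose
   stream is eventually constant 1 is translated by an element of H of bounded
   length under alpha and beta, and this recovers h from its image in G. *)


(** * Word metrics and symmetric groups *)

Section WordLength.
Local Open Scope group_scope.
Local Open Scope classical_set_scope.
Variable G : groupType.
Implicit Types (S : seq G) (g h : G).

Lemma has_word1 S : has_word S 1 0.
Proof. by exists [::]; split => //; rewrite big_nil. Qed.

Lemma has_word_gen S g : g \in S -> has_word S g 1.
Proof. by move=> gS; exists [:: g]; rewrite /= gS big_seq1. Qed.

Lemma has_wordM S g h k l :
  has_word S g k -> has_word S h l -> has_word S (g * h) (k + l).
Proof.
move=> [v [vS <- <-]] [w [wS <- <-]]; exists (v ++ w).
by split; rewrite ?all_cat ?vS ?size_cat ?big_cat.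
Qed.

Lemma has_wordV S g k : has_word S g k -> has_word S g^-1 k.
Proof.
move=> [w [wS <- <-]]; exists (rev [seq x^-1 | x <- w]); split.
- rewrite all_rev all_map; apply: sub_all wS => x /=.
  by rewrite invgK orbC.
- by rewrite size_rev size_map.
elim: w {wS} => [|x w IH]; first by rewrite !big_nil invg1.
by rewrite /= rev_cons -cats1 big_cat /= IH big_seq1 big_cons invgM.
Qed.

Lemma generates_ind S (K : G -> Prop) :
  generates S -> K 1 -> (forall g h, K g -> K h -> K (g * h)) ->
  (forall g, K g -> K g^-1) -> (forall g, g \in S -> K g) -> forall g, K g.
Proof.
move=> genS K1 KM KV KS g.
have : [set: G] g by [].
rewrite -genS => /(_ [set g | K g]); apply; split => /=; last exact: KS.
split; first by rewrite in_setE.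
by move=> x y; rewrite !in_setE /= => Kx /KV Ky; exact: KM.
Qed.

Lemma has_word_exists S g : generates S -> exists k, has_word S g k.
Proof.
move=> genS; elim/(@generates_ind S): g => //.
- by exists 0%N; exact: has_word1.
- by move=> g h [k kg] [l lh]; exists (k + l)%N; exact: has_wordM.
- by move=> g [k kg]; exists k; exact: has_wordV.
- by move=> g gS; exists 1%N; exact: has_word_gen.
Qed.

Lemma word_lengthP S g : generates S -> has_word S g (word_length S g).
Proof.
move=> genS; rewrite /word_length; case: pselect => [ex|[]].
  by case: ex_minnP => k /asboolP.
by have [k kg] := has_word_exists g genS; exists k; apply/asboolP.
Qed.

Lemma word_length_le S g k : has_word S g k -> word_length S g <= k.
Proof.
move=> kg; rewrite /word_length; case: pselect => [ex|] //.
by case: ex_minnP => l _; apply; apply/asboolP.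
Qed.

Lemma word_length1 S : word_length S 1 = 0%N.
Proof. by apply/eqP; rewrite -leqn0; apply/word_length_le/has_word1. Qed.

Lemma word_lengthM S g h : generates S ->
  word_length S (g * h) <= word_length S g + word_length S h.
Proof. by move=> genS; apply/word_length_le/has_wordM; exact: word_lengthP. Qed.

Lemma word_lengthV S g : generates S -> word_length S g^-1 <= word_length S g.
Proof. by move=> genS; apply/word_length_le/has_wordV; exact: word_lengthP. Qed.

(** Read [K g k] as: g has size at most k, for some length function on G. If [c] bounds the sizes of
    the finitely many generators, a word of length l has size at most c * l. *)
Lemma word_length_bound S (K : G -> nat -> Prop) :
  generates S -> K 1 0 ->
  (forall g h k l, K g k -> K h l -> K (g * h) (k + l)%N) ->
  (forall g k, K g k -> K g^-1 k) ->
  (forall g k l, K g k -> k <= l -> K g l) ->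
  (forall g, exists k, K g k) ->
  exists c, forall g, K g (c * word_length S g)%N.
Proof.
move=> genS K1 KM KV Kle Kex.
have [c cP] : exists c, forall g, g \in S -> K g c.
  elim: S {genS} => [|x S [c cP]]; first by exists 0%N.
  have [k xk] := Kex x; exists (maxn k c) => g; rewrite inE => /predU1P[->|gS].
    exact: Kle xk (leq_maxl _ _).
  exact: Kle (cP g gS) (leq_maxr _ _).
exists c => g; have [w [wS <- <-]] := word_lengthP g genS.
elim: w wS => [|x w IH] /=; first by rewrite big_nil muln0.
case/andP=> xS /IH wK; rewrite big_cons mulnS; apply: KM wK.
by case/orP: xS => /cP // /KV; rewrite invgK.
Qed.

End WordLength.

Section QIEmbedding.
Import Order.TTheory GRing.Theory Num.Theory.
Local Open Scope ring_scope.
Variables (R : realType) (H G : groupType) (f : {multiplicative H -> G}).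

Lemma multiplicative1 : f 1%g = 1%g.
Proof. by apply: (mulgI (f 1%g)); rewrite -gmulfM !mulg1. Qed.

Lemma multiplicativeV x : f x^-1%g = (f x)^-1%g.
Proof. by apply: (mulgI (f x)); rewrite -gmulfM !mulgV multiplicative1. Qed.

(** The upper bound comes from the images of the generators of H. For the lower one, [K] is a length
    function on G, hence at most linear in the word length for [T], and it dominates the word length
    in H along [f]. *)
Lemma qi_embedding_of_bounds (S : seq H) (T : seq G) (K : G -> nat -> Prop) :
  generates S -> generates T -> K 1%g 0%N ->
  (forall g h k l, K g k -> K h l -> K (g * h)%g (k + l)%N) ->
  (forall g k, K g k -> K g^-1%g k) ->
  (forall g k l, K g k -> (k <= l)%N -> K g l) ->
  (forall g, exists k, K g k) ->
  (forall x k, K (f x) k -> word_length S x <= k)%N ->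
  qi_embedding (fun x y => (word_metric S x y)%:R : R)
               (fun x y => (word_metric T x y)%:R : R) f.
Proof.
move=> genS genT K1 KM KV Kle Kex Kf.
have [c cP] := word_length_bound genT K1 KM KV Kle Kex.
have [d dP] : exists d, forall x, (word_length T (f x) <= d * word_length S x)%N.
  apply: (@word_length_bound _ S (fun x k => word_length T (f x) <= k)%N) => //.
  - by rewrite multiplicative1 word_length1.
  - move=> x y k l xk yl; rewrite gmulfM.
    exact: leq_trans (word_lengthM _ _ genT) (leq_add xk yl).
  - move=> x k; apply: leq_trans; rewrite multiplicativeV.
    exact: word_lengthV.
  - by move=> x k l; exact: leq_trans.
  - by move=> x; exists (word_length T (f x)).
(* One constant serves on both sides; the successor makes it at least 1. *)
pose e := (c + d).+1.
exists e%:R, 0; split; rewrite ?ler1n // => x y.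
rewrite /word_metric -multiplicativeV -gmulfM; set z := (x^-1 * y)%g.
rewrite subr0 addr0 ler_pdivrMl ?ltr0n // -!natrM !ler_nat; apply/andP; split.
  apply: leq_trans (Kf _ _ (cP _)) _; rewrite leq_mul2r /e; lia.
apply: leq_trans (dP _) _; rewrite leq_mul2r /e; lia.
Qed.

End QIEmbedding.

(** * The group of all permutations of a type *)

Section SymmetricGroup.

(** The inverse is stored with the map, so that it need not be chosen; as the map determines it,
    equality in the group is pointwise equality ([symP]). *)
Record sym (Y : Type) := Sym {
  sym_fun :> Y -> Y;
  sym_inv : Y -> Y;
  sym_funK : cancel sym_fun sym_inv;
  sym_invK : cancel sym_inv sym_fun }.

Variable Y : Type.

HB.instance Definition _ := gen_eqMixin (sym Y).
HB.instance Definition _ := gen_choiceMixin (sym Y).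

Lemma symP (g h : sym Y) : (forall y, g y = h y) -> g = h.
Proof.
case: g h => [g g' gK g'K] [h h' hK h'K] /= gh.
have {gh} eqgh : g = h by apply/funext.
have eqgh' : g' = h' by apply/funext => y; rewrite -{1}(h'K y) -eqgh gK.
rewrite {}eqgh {}eqgh' in gK g'K *.
by congr Sym; exact: Prop_irrelevance.
Qed.

Definition sym_one := @Sym Y id id (fun=> erefl) (fun=> erefl).
Definition sym_mul (g h : sym Y) : sym Y :=
  Sym (can_comp (sym_funK g) (sym_funK h)) (can_comp (sym_invK h) (sym_invK g)).
Definition sym_opp (g : sym Y) : sym Y := Sym (sym_invK g) (sym_funK g).

Fact sym_mulA : associative sym_mul.
Proof. by move=> f g h; exact: symP. Qed.
Fact sym_mul1 : left_id sym_one sym_mul.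
Proof. by move=> g; exact: symP. Qed.
Fact sym_mulr1 : right_id sym_one sym_mul.
Proof. by move=> g; exact: symP. Qed.
Fact sym_mulV : left_inverse sym_one sym_opp sym_mul.
Proof. by move=> g; apply: symP => y /=; rewrite sym_funK. Qed.
Fact sym_mulrV : right_inverse sym_one sym_opp sym_mul.
Proof. by move=> g; apply: symP => y /=; rewrite sym_invK. Qed.

HB.instance Definition _ := isGroup.Build (sym Y)
  sym_mulA sym_mul1 sym_mulr1 sym_mulV sym_mulrV.

Local Open Scope group_scope.
Implicit Types g h : sym Y.

Lemma sym1E y : (1 : sym Y) y = y. Proof. by []. Qed.
Lemma symME g h y : (g * h) y = g (h y). Proof. by []. Qed.
Lemma symKV g y : g (g^-1 y) = y. Proof. exact: sym_invK. Qed.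
Lemma symVK g y : g^-1 (g y) = y. Proof. exact: sym_funK. Qed.
Lemma sym_inj g : injective g. Proof. exact: can_inj (sym_funK g). Qed.
Lemma symXE g k y : (g ^+ k) y = iter k g y.
Proof. by elim: k => // k IH; rewrite expgS symME IH. Qed.

Lemma sym_eqV g x y : g x = y -> g^-1 y = x.
Proof. by move<-; rewrite symVK. Qed.

Lemma sym_fixV g y : g y = y -> g^-1 y = y.
Proof. exact: sym_eqV. Qed.

End SymmetricGroup.

Section Subgroup.
Local Open Scope group_scope.
Local Open Scope classical_set_scope.
Variables (G : groupType) (A : set G).

Lemma generated_subgroup_closed : group_closed [in generated_subgroup A].
Proof.
split; first by rewrite in_setE => K [[+ _] _]; rewrite in_setE.
move=> x y; rewrite !in_setE => gx gy K KA.
have := KA.1.2 x y; rewrite !in_setE; apply; [exact: gx|exact: gy].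
Qed.

Lemma sub_generated_subgroup : A `<=` generated_subgroup A.
Proof. by move=> g Ag K [_]; exact. Qed.

Definition subgroup_of := {g : G | g \in generated_subgroup A}.

HB.instance Definition _ := SubType.copy subgroup_of {g : G | g \in generated_subgroup A}.
HB.instance Definition _ := Choice.copy subgroup_of {g : G | g \in generated_subgroup A}.
HB.instance Definition _ :=
  SubChoice_isSubGroup.Build G [in generated_subgroup A] subgroup_of
    generated_subgroup_closed.

Lemma subgroup_ind (C : subgroup_of -> Prop) : C 1 ->
  (forall x y, C x -> C y -> C (x * y)) -> (forall x, C x -> C x^-1) ->
  (forall x : subgroup_of, A (val x) -> C x) -> forall x, C x.
Proof.
move=> C1 CM CV CA x.
have Ax : generated_subgroup A (val x) by rewrite -in_setE; exact: valP.
(* [C] lives on the subtype, so the closed set of elements of G to use is its image under [val]. *)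
have [] : [set g | exists2 y : subgroup_of, val y = g & C y] (val x); last first.
  by move=> y /val_inj ->.
apply: Ax; split; last first.
  move=> g Ag; have gA := mem_set (sub_generated_subgroup Ag).
  by exists (Sub g gA) => //; apply: CA.
split; first by rewrite in_setE; exists 1; rewrite ?val1.
move=> g h; rewrite !in_setE => -[y <- Cy] [z <- Cz].
by exists (y * z^-1); [rewrite valM|apply/CM/CV].
Qed.

Lemma val_expg (x : subgroup_of) k : val (x ^+ k) = val x ^+ k.
Proof. by elim: k => [|k IH]; rewrite ?expg0 ?val1 // !expgS valM IH. Qed.

Lemma subgroup_has_order (x : subgroup_of) k : has_order (val x) k -> has_order x k.
Proof.
move=> [k0 xk xj]; split => // [|j jk xj1]; first by apply: val_inj; rewrite val_expg val1.
by apply: (xj j jk); rewrite -val_expg xj1 val1.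
Qed.

End Subgroup.

(** * Three-cycles of bricks *)

Section Bricks.
Local Open Scope group_scope.
Variables (Y W : Type).
Implicit Types (g p : sym Y) (a b c d : W -> Y).

Definition disj b c := forall v w, b v <> c w.

Lemma disj_sym b c : disj b c -> disj c b.
Proof. by move=> bc v w /esym; exact: bc. Qed.

(** A brick is given with its parametrization by [W], and cycles of bricks have to respect the
    parametrizations. *)
Definition is2 g b c :=
  [/\ forall w, g (b w) = c w, forall w, g (c w) = b w &
      forall y, (forall w, y <> b w) -> (forall w, y <> c w) -> g y = y].

Definition is3 g a b c :=
  [/\ forall w, g (a w) = b w, forall w, g (b w) = c w,
      forall w, g (c w) = a w &
      forall y, (forall w, y <> a w) -> (forall w, y <> b w) ->
        (forall w, y <> c w) -> g y = y].

Definition has3 (N : set (sym Y)) a b c := exists2 g, N g & is3 g a b c.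

Lemma is3_conj p g a b c : is3 g a b c ->
  is3 (p * g * p^-1) (p \o a) (p \o b) (p \o c).
Proof.
move=> [ab bc ca fx]; split=> [w|w|w|y ya yb yc]; rewrite !symME /comp.
- by rewrite symVK ab.
- by rewrite symVK bc.
- by rewrite symVK ca.
rewrite fx ?symKV // => w yw; [apply: (ya w)|apply: (yb w)|apply: (yc w)];
  by rewrite /comp -yw symKV.
Qed.

Lemma is3_ext g a b c a' b' c' : a =1 a' -> b =1 b' -> c =1 c' ->
  is3 g a b c -> is3 g a' b' c'.
Proof. by move=> /funext <- /funext <- /funext <-. Qed.

(* The commutator of two permutations whose supports meet in a single brick
   is a 3-cycle of bricks. *)
Lemma is3_commutator (x y : sym Y) b :
  (forall w, y (x (b w)) = x (b w)) -> (forall w, x (y (b w)) = y (b w)) ->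
  (forall w, y (x^-1 (b w)) = x^-1 (b w)) ->
  (forall w, x (y^-1 (b w)) = y^-1 (b w)) ->
  (forall z, (forall w, z <> b w) -> x z = z \/ y z = z) ->
  is3 (x * y * x^-1 * y^-1) b (x \o b) (y \o b).
Proof.
move=> yx xy yx' xy' xyP; split=> [w|w|w|z zb zxb zyb]; rewrite !symME /comp.
- by rewrite (sym_fixV (xy' w)) symKV.
- by rewrite (sym_fixV (yx w)) symVK xy.
- by rewrite symVK yx' symKV.
case: (xyP z zb) => [xz|yz].
  have [yz|yz] := pselect (y z = z).
    by rewrite (sym_fixV yz) (sym_fixV xz) yz xz.
  (* With z, also y^-1 z is moved by y, so x fixes it unless it lies in [b]. *)
  case: (xyP (y^-1 z)) => [w yw|xyz|yyz].
  - by apply: (zyb w); rewrite /= -yw symKV.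
  - by rewrite (sym_fixV xyz) symKV.
  - by case: yz; rewrite symKV in yyz; rewrite {1}yyz symKV.
rewrite (sym_fixV yz).
have [xz|xz] := pselect (x z = z); first by rewrite (sym_fixV xz) yz xz.
case: (xyP (x^-1 z)) => [w xw|xxz|yxz].
- by apply: (zxb w); rewrite /= -xw symKV.
- by case: xz; rewrite symKV in xxz; rewrite {1}xxz symKV.
- by rewrite yxz symKV.
Qed.

Lemma has3_rot N a b c : has3 N a b c -> has3 N b c a.
Proof.
by move=> [g Ng [ab bc ca fx]]; exists g => //; split => // y yb yc ya; exact: fx.
Qed.

Section Normal.
Variables P N : set (sym Y).
Hypothesis NV : forall g, N g -> N g^-1.
Hypothesis NJ : forall p g, P p -> N g -> N (p * g * p^-1).

Lemma has3_rev a b c : has3 N a b c -> has3 N a c b.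
Proof.
move=> [g Ng [ab bc ca fx]]; exists g^-1; first exact: NV.
split=> [w|w|w|y ya yc yb]; [exact: sym_eqV|exact: sym_eqV|exact: sym_eqV|].
by apply: sym_fixV; exact: fx.
Qed.

(** In the applications [P] is the whole group and [N] is either the group or a normal subgroup of
    it. *)
Lemma has3_conj p a b c a' b' c' : P p ->
  (forall w, p (a w) = a' w) -> (forall w, p (b w) = b' w) ->
  (forall w, p (c w) = c' w) -> has3 N a b c -> has3 N a' b' c'.
Proof.
move=> Pp pa pb pc [g Ng g3]; exists (p * g * p^-1); first exact: NJ.
exact: is3_ext pa pb pc (is3_conj p g3).
Qed.

End Normal.

(* A transposition of two bricks is a double transposition of half bricks, hence
   a product of two 3-cycles. *)
Lemma is2_halves N (i0 i1 : W -> W) b c g :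
  (forall x y, N x -> N y -> N (x * y)) ->
  (forall w, (exists v, w = i0 v) \/ (exists v, w = i1 v)) ->
  (forall v w, i0 v <> i1 w) -> injective b -> injective c -> disj b c ->
  has3 N (b \o i0) (c \o i0) (b \o i1) -> has3 N (c \o i0) (b \o i1) (c \o i1) ->
  is2 g b c -> N g.
Proof.
move=> NM i01 di bI cI bc [x Nx [x1 x2 x3 xf]] [y Ny [y1 y2 y3 yf]] [gb gc gf].
suff -> : g = x * y by exact: NM.
rewrite /= in x1 x2 x3 xf y1 y2 y3 yf.
apply: symP => z; rewrite symME.
have [[w ->]|zb] := pselect (exists w, z = b w).
  rewrite gb; case: (i01 w) => -[v ->].
    by rewrite yf ?x1 // => u /bI; exact: di.
  have cb : disj c b by exact: disj_sym.
  by rewrite y2 xf // => u /cI/esym; exact: di.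
have [[w ->]|zc] := pselect (exists w, z = c w).
  rewrite gc; case: (i01 w) => -[v ->]; first by rewrite y1 x3.
  by rewrite y3 x2.
have zb' w : z <> b w by move=> zw; apply: zb; exists w.
have zc' w : z <> c w by move=> zw; apply: zc; exists w.
by rewrite gf // yf ?xf // => u.
Qed.

End Bricks.

(** * Products of disjoint cycles of bricks *)

Section Rotation.
Local Open Scope group_scope.
Variables (L W : Type).

Section Rot.
Variables (lt : nat -> nat -> L) (gn : nat -> nat -> W -> W) (q p : nat).

(** There are [q] cycles of length [p]. The j-th place of the e-th cycle is not the whole letter
    [lt e j], only the image of [gn e j] in it. *)
Definition rot_block e j w : L * W := (lt e j, gn e j w).

Definition lt_inj := forall e e' j j', e < q -> e' < q -> j < p -> j' < p ->
  lt e j = lt e' j' -> e = e' /\ j = j'.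

Definition in_rot (y : L * W) :=
  exists ejw : nat * nat * W, [/\ ejw.1.1 < q, ejw.1.2 < p &
    y = rot_block ejw.1.1 ejw.1.2 ejw.2].

(** The triple (e, j, w) is chosen classically; [lt_inj] and the injectivity of the maps [gn e j]
    make it unique. *)
Definition rot_fun (y : L * W) : L * W :=
  if pselect (in_rot y) is left h then
    let: (e, j, w) := projT1 (cid h) in rot_block e (j.+1 %% p) w
  else y.

Lemma in_rotP y : in_rot y -> exists e j w, [/\ e < q, j < p & y = rot_block e j w].
Proof. by move=> [[[e j] w]]; exists e, j, w. Qed.

Hypothesis p_gt0 : 0 < p.
Hypothesis gnI : forall e j, injective (gn e j).
Hypothesis ltI : lt_inj.

Lemma rot_fun_block e j w : e < q -> j < p ->
  rot_fun (rot_block e j w) = rot_block e (j.+1 %% p) w.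
Proof.
move=> le jp; rewrite /rot_fun; case: pselect => [h|[]]; last first.
  by exists (e, j, w).
case: cid => -[[e' j'] w'] /= [le' jp' [/(ltI le le' jp jp')[<- <-]]].
by move/gnI => ->.
Qed.

Lemma rot_fun_fix y : ~ in_rot y -> rot_fun y = y.
Proof. by rewrite /rot_fun; case: pselect. Qed.

Lemma rot_fun_iter k e j w : e < q -> j < p ->
  iter k rot_fun (rot_block e j w) = rot_block e ((j + k) %% p) w.
Proof.
move=> le jp; elim: k => [|k IH]; first by rewrite addn0 modn_small.
rewrite iterS IH rot_fun_block ?ltn_mod //.
by rewrite -addn1 modnDml addn1 addnS.
Qed.

Lemma rot_fun_period y : iter p rot_fun y = y.
Proof.
have [[[[e j] w] /= [le jp ->]]|ny] := pselect (in_rot y).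
  by rewrite rot_fun_iter // modnDr modn_small.
have iter_fix k : iter k rot_fun y = y.
  by elim: k => // k IH; rewrite iterS IH rot_fun_fix.
exact: iter_fix.
Qed.

Fact rot_funK : cancel rot_fun (iter p.-1 rot_fun).
Proof. by move=> y; rewrite -iterSr prednK // rot_fun_period. Qed.
Fact rot_invK : cancel (iter p.-1 rot_fun) rot_fun.
Proof. by move=> y; rewrite -iterS prednK // rot_fun_period. Qed.

Definition brickrot : sym (L * W) := Sym rot_funK rot_invK.

Lemma rotE e j w : e < q -> j.+1 < p -> brickrot (rot_block e j w) = rot_block e j.+1 w.
Proof. by move=> le jp; rewrite [LHS]rot_fun_block ?(ltnW jp) // modn_small. Qed.

Lemma rotE0 e w : e < q -> brickrot (rot_block e p.-1 w) = rot_block e 0 w.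
Proof. by move=> le; rewrite [LHS]rot_fun_block ?prednK // modnn. Qed.

Lemma rotXp : brickrot ^+ p = 1.
Proof. by apply: symP => y; rewrite symXE rot_fun_period. Qed.

Lemma rot_has_order : W -> 0 < q -> has_order brickrot p.
Proof.
move=> w q0; split; [exact: p_gt0|exact: rotXp|move=> j /andP[j0 jp] rj].
have : (brickrot ^+ j) (rot_block 0 0 w) = rot_block 0 j w.
  by rewrite symXE [LHS]rot_fun_iter // add0n modn_small.
rewrite rj sym1E => -[ej _].
have [_ /esym/eqP] := ltI q0 q0 p_gt0 jp ej.
by rewrite eqn0Ngt j0.
Qed.

End Rot.

Section Transpositions.
Variable N : set (sym (L * W)).
Hypothesis N1 : N 1.
Hypothesis NM : forall x y, N x -> N y -> N (x * y).

(** Induction on the length: a cycle is the product of the cycle [r] of all its bricks but the last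
    and the swap [s] of its last two bricks, with [s] applied first. *)
Lemma one_cycle_transpositions lt gn p (g : sym (L * W)) :
  (forall e j, injective (gn e j)) -> 0 < p -> lt_inj lt 1 p ->
  (forall j j' s, j < p -> j' < p -> j <> j' ->
    is2 s (rot_block lt gn 0 j) (rot_block lt gn 0 j') -> N s) ->
  (forall y, g y = rot_fun lt gn 1 p y) -> N g.
Proof.
move=> gnI; elim: p g => [//|[|p] IH] g _ ltI NS gE.
  suff -> : g = 1 by [].
  by apply: symP => y; rewrite gE; exact: (rot_fun_period (ltn0Sn 0) gnI ltI).
have ltI1 : lt_inj lt 1 p.+1.
  by move=> e e' j j' ? ? jp jp'; apply: ltI => //; exact: ltnW.
pose lt2 (_ : nat) j := lt 0 (p + j); pose gn2 (_ : nat) j := gn 0 (p + j).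
have gn2I e j : injective (gn2 e j) by exact: gnI.
have lt2I : lt_inj lt2 1 2.
  move=> e e' j j' /[!ltnS]/[!leqn0]/eqP-> /eqP-> j2 j2' /ltI.
  by case=> //; lia.
pose r := brickrot (ltn0Sn p) gnI ltI1.
pose s := brickrot (ltn0Sn 1) gn2I lt2I.
have s0 w : s (rot_block lt gn 0 p w) = rot_block lt gn 0 p.+1 w.
  have := @rotE _ _ 1 2 isT gn2I lt2I 0 0 w isT isT.
  by rewrite -/s /rot_block /lt2 /gn2 addn0 addn1.
have s1 w : s (rot_block lt gn 0 p.+1 w) = rot_block lt gn 0 p w.
  have := @rotE0 _ _ 1 2 isT gn2I lt2I 0 w isT.
  by rewrite -/s /rot_block /lt2 /gn2 addn0 addn1.
have s2 y : (forall w, y <> rot_block lt gn 0 p w) ->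
    (forall w, y <> rot_block lt gn 0 p.+1 w) -> s y = y.
  move=> y0 y1; apply: rot_fun_fix => -[[[e [|[|j]]] w]] /= [_ // _ yE].
    by apply: (y0 w); rewrite yE /rot_block /lt2 /gn2 addn0.
  by apply: (y1 w); rewrite yE /rot_block /lt2 /gn2 addn1.
have Ns : N s by apply: (NS p p.+1) => //; lia.
have Nr : N r.
  apply: (IH r isT ltI1) => // j j' u jp jp'.
  by apply: NS => //; exact: ltnW.
suff -> : g = r * s by exact: NM.
apply: symP => y; rewrite gE symME.
have [/in_rotP[e [j [w [+ jp ->]]]]|ny] := pselect (in_rot lt gn 1 p.+2 y).
  rewrite ltnS leqn0 => /eqP->; rewrite rot_fun_block //.
  have [->|jp1] := eqVneq j p.+1.
    rewrite s1 modnn [RHS](@rot_fun_block lt gn 1 p.+1) // modnn //.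
  have [->|jp0] := eqVneq j p.
    rewrite s0 modn_small // [RHS]rot_fun_fix // => -[[[e' j'] w']] /=.
    by case=> le' jp' [/ltI[] //]; lia.
  rewrite s2; last 2 first.
  - by move=> v [/ltI[] //]; lia.
  - by move=> v [/ltI[] //]; lia.
  by rewrite [RHS](@rot_fun_block lt gn 1 p.+1) // ?modn_small //; lia.
rewrite s2; last 2 first.
- by move=> w yw; apply: ny; exists (0, p, w).
- by move=> w yw; apply: ny; exists (0, p.+1, w).
rewrite rot_fun_fix // [RHS]rot_fun_fix // => -[[[e j] w] /= [le jp yE]]; apply: ny.
by exists (e, j, w); split => //; exact: ltnW.
Qed.

(** Induction on the number of cycles: the last one has support disjoint from the others and splits
    off as a factor. *)
Lemma rot_transpositions lt gn q p (g : sym (L * W)) :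
  (forall e j, injective (gn e j)) -> 0 < p -> lt_inj lt q p ->
  (forall e j j' s, e < q -> j < p -> j' < p -> j <> j' ->
    is2 s (rot_block lt gn e j) (rot_block lt gn e j') -> N s) ->
  (forall y, g y = rot_fun lt gn q p y) -> N g.
Proof.
move=> gnI p0; elim: q g => [|q IH] g ltI NS gE.
  suff -> : g = 1 by [].
  by apply: symP => y; rewrite gE rot_fun_fix // => -[? []].
have ltIq : lt_inj lt q p.
  by move=> e e' j j' le le'; apply: ltI; exact: ltnW.
pose lt1 (_ : nat) := lt q; pose gn1 (_ : nat) := gn q.
have gn1I e j : injective (gn1 e j) by exact: gnI.
have lt1I : lt_inj lt1 1 p.
  move=> e e' j j' /[!ltnS]/[!leqn0]/eqP-> /eqP-> jp jp' /ltI.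
  by case.
pose r := brickrot p0 gnI ltIq; pose s := brickrot p0 gn1I lt1I.
have Nr : N r.
  by apply: (IH r ltIq) => // e j j' u le; apply: NS; exact: ltnW.
have Ns : N s.
  by apply: (one_cycle_transpositions gn1I p0 lt1I) => // j j' u; apply: NS.
suff -> : g = r * s by exact: NM.
apply: symP => y; rewrite gE symME.
have [/in_rotP[e [j [w [le jp ->]]]]|ny] := pselect (in_rot lt gn q.+1 p y).
  rewrite rot_fun_block //; have [eq|eq] := eqVneq e q.
    have -> : s (rot_block lt gn e j w) = rot_block lt gn e (j.+1 %% p) w.
      by have := @rot_fun_block lt1 gn1 1 p gn1I lt1I 0 j w isT jp; rewrite eq.
    rewrite [RHS]rot_fun_fix // => -[[[e' j'] w'] /= [le' jp' [/ltI[]]]] //.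
    - exact: ltnW.
    - by rewrite ltn_mod.
    - lia.
  rewrite [s _]rot_fun_fix; last first.
    by move=> [[[e' j'] w'] /= [le' jp' [/ltI[] //]]]; lia.
  by rewrite [RHS](@rot_fun_block lt gn q p) //; lia.
rewrite [s _]rot_fun_fix; last first.
  by move=> [[[e' j'] w'] /= [le' jp' yE]]; apply: ny; exists (q, j', w').
rewrite rot_fun_fix // [RHS]rot_fun_fix // => -[[[e j] w] /= [le jp yE]]; apply: ny.
by exists (e, j, w); split => //; exact: ltnW.
Qed.

End Transpositions.

End Rotation.

(** * Streams *)

Section Streams.
Local Open Scope group_scope.
Variable H : groupType.

(** The index [None] is the one that H fixes. *)
Definition stream := option H -> nat -> bool.

Inductive gen := Nop | Push of option H & bool | Act of H.

Definition gact (a : gen) (w : stream) : stream :=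
  match a with
  | Nop => w
  | Push s b => fun t i =>
      if t == s then (if i is k.+1 then w s k else b) else w t i
  | Act h => fun t i => w (omap (fun u => h^-1 * u) t) i
  end.

(** For a push this drops the first digit whatever it is, so it is a left inverse everywhere but a
    right inverse only on the image, which [gmem] describes. *)
Definition ginv (a : gen) (w : stream) : stream :=
  match a with
  | Nop => w
  | Push s b => fun t i => if t == s then w t i.+1 else w t i
  | Act h => gact (Act h^-1) w
  end.

Definition gmem (a : gen) (w : stream) : bool :=
  if a is Push s b then w s 0 == b else true.

Lemma streamP (v w : stream) : (forall t i, v t i = w t i) -> v = w.
Proof. by move=> vw; apply/funext => t; apply/funext => i; exact: vw. Qed.

Lemma gactK a : cancel (gact a) (ginv a).
Proof.
case: a => [|s b|h] w //; apply: streamP => t i /=.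
  by have [->|] := eqVneq t s; rewrite ?eqxx.
by case: t => [t|] //=; rewrite invgK mulgA mulVg mul1g.
Qed.

Lemma ginvK a w : gmem a w -> gact a (ginv a w) = w.
Proof.
case: a => [|s b|h] //= => [/eqP wb|_]; apply: streamP => t i /=.
  by case: eqVneq => // ->; rewrite eqxx; case: i.
by case: t => [t|] //=; rewrite invgK mulgA mulgV mul1g.
Qed.

Lemma gact_inj a : injective (gact a).
Proof. exact: can_inj (gactK a). Qed.

Lemma gmem_act a w : gmem a (gact a w).
Proof. by case: a => //= s b; rewrite !eqxx. Qed.

Lemma gact1 w : gact (Act 1) w = w.
Proof. by apply: streamP => -[t|] i //=; rewrite invg1 mul1g. Qed.

Lemma gactM h k w : gact (Act h) (gact (Act k) w) = gact (Act (h * k)) w.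
Proof. by apply: streamP => -[t|] i //=; rewrite invgM mulgA. Qed.

(** This is why finitely many labels suffice: H and the pushes at the indices 1 and [None] yield the
    pushes at all indices. *)
Lemma gact_conj h b w :
  gact (Act h) (gact (Push (Some 1) b) (gact (Act h^-1) w)) = gact (Push (Some h) b) w.
Proof.
apply: streamP => -[t|] i //=.
have -> : (Some (h^-1 * t) == Some 1) = (Some t == Some h).
  by rewrite !(inj_eq Some_inj) mulg_eq1 eqg_inv eq_sym.
case: ifP => [_|_]; last by rewrite invgK mulgA mulgV mul1g.
by case: i => // i; rewrite invgK mulg1.
Qed.

(** Hence H acts inside each half of a letter, the halves being told apart by the first digit at
    [None]. *)
Lemma gact_pushN h b w :
  gact (Act h) (gact (Push None b) w) = gact (Push None b) (gact (Act h) w).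
Proof. by apply: streamP => -[t|] i. Qed.

(* The coordinates in H on which w is eventually true: H acts on them by left
   translation, and they do not see the letters added by Push. *)
Definition ev (w : stream) (t : H) : Prop :=
  exists k, forall i, k <= i -> w (Some t) i.

Lemma ev_push s b w t : ev (gact (Push s b) w) t <-> ev w t.
Proof.
split=> -[k kP] /=.
  exists k => i ki; move: (kP _ (leqW ki)) (kP _ ki) => /=.
  by case: eqVneq => // ->.
exists k.+1 => -[//|i] ki /=; case: eqVneq => [<-|_]; apply: kP => //.
exact: ltnW.
Qed.

Lemma ev_act h w t : ev (gact (Act h) w) t <-> ev w (h^-1 * t).
Proof. by []. Qed.

(** These are the basic neighbourhoods of the product topology; [locally_agree] is continuity at a
    point. *)
Definition agree (F : seq (option H * nat)) (v w : stream) :=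
  forall s i, (s, i) \in F -> v s i = w s i.

Definition locally_agree (f : stream -> stream) w :=
  forall F, exists F', forall v, agree F' v w -> agree F (f v) (f w).

Lemma agree_cat F1 F2 v w : agree (F1 ++ F2) v w -> agree F1 v w /\ agree F2 v w.
Proof.
by move=> vw; split=> s i si; apply: vw; rewrite mem_cat si ?orbT.
Qed.

Lemma locally_agree_coord (f : stream -> stream) w :
  (forall s i, exists p, forall v, v p.1 p.2 = w p.1 p.2 -> f v s i = f w s i) ->
  locally_agree f w.
Proof.
move=> fP F; elim: F => [|[s i] F [F' F'P]]; first by exists [::].
have [p pP] := fP s i; exists (p :: F') => v vw s' i'.
rewrite inE => /predU1P[[-> ->]|si].
  by apply: pP; apply: vw; rewrite inE -surjective_pairing eqxx.
by apply: F'P si => s2 i2 si2; apply: vw; rewrite inE si2 orbT.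
Qed.

Lemma gact_locally_agree a w : locally_agree (gact a) w.
Proof.
apply: locally_agree_coord => t i; case: a => [|s b|h] /=.
- by exists (t, i).
- case: eqVneq => _; last by exists (t, i).
  by case: i => [|i]; [exists (t, 0)|exists (s, i)].
- by exists (omap (fun u => h^-1 * u) t, i).
Qed.

Lemma ginv_locally_agree a w : locally_agree (ginv a) w.
Proof.
case: a => [|s b|h].
- exact: (@gact_locally_agree Nop).
- apply: locally_agree_coord => t i /=.
  by case: eqVneq => _; [exists (t, i.+1)|exists (t, i)].
- exact: gact_locally_agree.
Qed.

Lemma gmem_local a w : exists F, forall v, agree F v w -> gmem a v = gmem a w.
Proof.
case: a => [|s b|h]; [by exists [::]| |by exists [::]].
by exists [:: (s, 0)] => v vw /=; rewrite vw // inE.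
Qed.

Inductive gword : (stream -> stream) -> Prop :=
| gword_id : gword id
| gword_comp a f : gword f -> gword (gact a \o f).

Lemma gword_cat f g : gword f -> gword g -> gword (f \o g).
Proof. by move=> ff gg; elim: ff => // a f' _; exact: gword_comp. Qed.

Lemma gword_gen a : gword (gact a).
Proof. exact: gword_comp gword_id. Qed.

Lemma gword_inj f : gword f -> injective f.
Proof. by elim=> // a f' _; exact: inj_comp (@gact_inj a). Qed.

(** A push inserts a constant digit and shifts the others of its stream; an element of H only
    permutes the indices. *)
Lemma gword_coord f s i : gword f ->
  (exists b, forall v, f v s i = b) \/ (exists p, forall v, f v s i = v p.1 p.2).
Proof.
move=> ff; elim: ff s i => [|a {}f _ IH] s i; first by right; exists (s, i).
case: a => [|s' b|h]; rewrite /comp /=; [exact: IH| |exact: IH].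
case: eqVneq => _; last exact: IH.
by case: i => [|i]; [left; exists b|exact: IH].
Qed.

(** The word pushes the digits 0 to i of [w] at the index s, the digit 0 being pushed last. *)
Lemma gword_fix_coord s i w : exists2 f, gword f &
  (exists w', w = f w') /\ forall v, f v s i = w s i.
Proof.
elim: i w => [|i IH] w.
  exists (gact (Push s (w s 0))); first exact: gword_gen.
  split=> [|v /=]; last by rewrite eqxx.
  by exists (ginv (Push s (w s 0)) w); rewrite ginvK /=.
have [f ff [[w' ww'] fP]] := IH (ginv (Push s (w s 0)) w).
exists (gact (Push s (w s 0)) \o f); first exact: gword_comp.
split=> [|v /=]; last by rewrite eqxx fP /= eqxx.
by exists w'; rewrite /comp -ww' ginvK /=.
Qed.

(** Bricks form a basis of neighbourhoods. The coordinates in F are fixed one by one: one that is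
    not yet constant on the image of f is a coordinate p of the argument, and a further word fixes
    that. *)
Lemma gword_nbhd F w : exists2 f, gword f &
  (exists w', w = f w') /\ forall v, agree F (f v) w.
Proof.
elim: F => [|[s i] F [f ff [[w' ww'] fP]]].
  by exists id; [exact: gword_id|split; [exists w|]].
have [[b bP]|[p pP]] := gword_coord s i ff.
  exists f => //; split=> [|v s' i']; first by exists w'.
  rewrite inE => /predU1P[[-> ->]|si]; last exact: fP.
  by rewrite ww' !bP.
have [g gg [[w2 w2P] gP]] := gword_fix_coord p.1 p.2 w'.
exists (f \o g); first exact: gword_cat.
split=> [|v s' i']; first by exists w2; rewrite /comp -w2P.
rewrite inE => /predU1P[[-> ->]|si]; last exact: fP.
by rewrite /comp ww' !pP.
Qed.

End Streams.

(** * Continuous maps on letters with streams *)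

Section ContinuousMaps.
Local Open Scope group_scope.
Variables (H : groupType) (L : Type).
Local Notation W := (stream H).

(* Continuity for the product topology on streams and the discrete one on L. *)
Definition cont (g : L * W -> L * W) :=
  forall x w F, exists F', forall v, agree F' v w ->
    (g (x, v)).1 = (g (x, w)).1 /\ agree F (g (x, v)).2 (g (x, w)).2.

Lemma cont_id : cont id.
Proof. by move=> x w F; exists F. Qed.

Lemma cont_comp g h : cont g -> cont h -> cont (g \o h).
Proof.
move=> cg ch x w F; rewrite /comp.
have [F1 F1P] := cg (h (x, w)).1 (h (x, w)).2 F.
have [F2 F2P] := ch x w F1; exists F2 => v /F2P[eq1 /F1P].
by rewrite -!eq1 -!surjective_pairing eq1 -surjective_pairing.
Qed.

Lemma cont_iter k g : cont g -> cont (iter k g).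
Proof.
move=> cg; elim: k => [|k IH]; first exact: cont_id.
exact: (cont_comp cg IH).
Qed.

End ContinuousMaps.

(** * The generators and their product *)

Section RotationOfStreams.
Variables (H : groupType) (L : Type) (lt : nat -> nat -> L).
Variables (gn : nat -> nat -> gen H) (q p : nat).
Hypothesis ltI : lt_inj lt q p.
Local Notation gnf := (fun e j => gact (gn e j)).

Lemma rot_funE e j w : e < q -> j < p ->
  rot_fun lt gnf q p (lt e j, w) =
  if gmem (gn e j) w then rot_block lt gnf e (j.+1 %% p) (ginv (gn e j) w)
  else (lt e j, w).
Proof.
move=> le jp; case: ifP => [mw|/negP nmw].
  rewrite -{1}(ginvK mw) -/(rot_block lt gnf e j _).
  by rewrite rot_fun_block // => ? ?; exact: gact_inj.
rewrite rot_fun_fix // => /in_rotP[e' [j' [w' [le' jp']]]].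
case=> /ltI[]// <- <- ww'; apply: nmw; rewrite ww'; exact: gmem_act.
Qed.

Lemma rot_fun_cont : cont (rot_fun lt gnf q p).
Proof.
move=> x w F.
have [[e [j [le jp ->]]]|nx] := pselect (exists e j, [/\ e < q, j < p & x = lt e j]).
  have [F1 F1P] := gmem_local (gn e j) w.
  have [F2 F2P] := gact_locally_agree (gn e (j.+1 %% p)) (ginv (gn e j) w) F.
  have [F3 F3P] := ginv_locally_agree (gn e j) w F2.
  (* [F1] decides whether v is in the brick, [F3] controls its image if it is, and [F] suffices if
     it is not. *)
  exists (F1 ++ (F3 ++ F)) => v /agree_cat[/F1P vw1 /agree_cat[/F3P vw3 vw]].
  by rewrite !rot_funE // vw1; case: ifP => //= _; split => //; exact: F2P.
exists F => v vw; rewrite !rot_fun_fix // => /in_rotP[e [j [u [le jp [xe _]]]]];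
  by apply: nx; exists e, j.
Qed.

End RotationOfStreams.

(* V i j, j < n, are the letters of the i-th cycle of beta; all other letters only
   serve to give the cycles of alpha the length m: V i j, n <= j, for the edge i
   of the polygon, Q b j for the chord b and Z k j for the link k. *)
Inductive letter := V of nat & nat | Q of nat & nat | Z of nat & nat.

Definition letter_code x := match x with
  | V i j => (0, i, j) | Q i j => (1, i, j) | Z i j => (2, i, j) end.
Definition letter_decode c := match c with
  | (0, i, j) => V i j | (1, i, j) => Q i j | (_, i, j) => Z i j end.
Fact letter_codeK : cancel letter_code letter_decode. Proof. by case. Qed.
HB.instance Definition _ := Equality.copy letter (can_type letter_codeK).

Section Generators.
Variables (H : groupType) (m n N : nat) (lk : seq (gen H)).
Local Notation W := (stream H).
Local Notation t := (size lk).
Local Notation K := (m + n - 3).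
Hypothesis m_ge2 : 2 <= m.
Hypothesis n_ge3 : 3 <= n.
(** The chords and links occupy 2t blocks of three vertices. At least ten plain vertices remain, and
    ten is also the supply of letters that [fresh] relies on. *)
Hypothesis N_large : 6 * t + 10 <= N.

(* alpha joins the letter rP i of the vertex i - 1 of a polygon (i modulo N) to the
   letter V i 0 of the vertex i. The vertex N - 1 is reversed: its letter 2 plays
   the role that the letter 1 has at the other vertices. *)
Definition rP i := if i == 0 then V N.-1 2 else V i.-1 1.

Definition ltB i j := V i j.
Definition gnB (_ _ : nat) : gen H := Nop H.

(* The cycles of alpha: N edges of the polygon, 2t chords, each of which cuts off a
   face around the letter V (3b + 1) 2, and t links between two such letters; the
   second brick of the k-th link carries the k-th label in lk. *)
Definition ltA e j :=
  if e < N then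
    match j with 0 => rP e | 1 => V e 0 | k.+2 => V e (n + k) end
  else if e < N + 2 * t then
    match j with
    | 0 => V (3 * (e - N)) 2
    | 1 => V (3 * (e - N) + 2) 2
    | k.+2 => Q (e - N) k
    end
  else
    match j with
    | 0 => V (6 * (e - N - 2 * t) + 1) 2
    | 1 => V (6 * (e - N - 2 * t) + 4) 2
    | k.+2 => Z (e - N - 2 * t) k
    end.

Definition gnA e j :=
  if (N + 2 * t <= e) && (j == 1) then nth (Nop H) lk (e - N - 2 * t) else Nop H.

Lemma ltB_inj : lt_inj ltB N n.
Proof. by move=> e e' j j' _ _ _ _ []. Qed.

Lemma ltA_inj : lt_inj ltA (N + 3 * t) m.
Proof.
move=> e e' j j' le le' jm jm'; rewrite /ltA /rP.
case: j jm => [|[|j]] jm; case: j' jm' => [|[|j']] jm';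
by do ![case: ifP => ?]; first [done | case; lia | move=> _; lia].
Qed.

Lemma m_gt0 : 0 < m. Proof. lia. Qed.
Lemma n_gt0 : 0 < n. Proof. lia. Qed.

Let gnAI e j : injective (gact (gnA e j)). Proof. exact: gact_inj. Qed.
Let gnBI e j : injective (gact (gnB e j)). Proof. exact: gact_inj. Qed.

Definition alpha : sym (letter * W) := brickrot m_gt0 gnAI ltA_inj.
Definition beta : sym (letter * W) := brickrot n_gt0 gnBI ltB_inj.

Local Notation blkA := (rot_block ltA (fun e j => gact (gnA e j))).

Lemma alpha_next e j w : e < N + 3 * t -> j.+1 < m ->
  alpha (blkA e j w) = blkA e j.+1 w.
Proof. exact: rotE. Qed.

Lemma alpha_last e w : e < N + 3 * t -> alpha (blkA e m.-1 w) = blkA e 0 w.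
Proof. exact: rotE0. Qed.

Lemma beta_next i j w : i < N -> j.+1 < n -> beta (V i j, w) = (V i j.+1, w).
Proof. exact: (@rotE _ _ ltB (fun e j => gact (gnB e j))). Qed.

Lemma beta_last i w : i < N -> beta (V i n.-1, w) = (V i 0, w).
Proof. exact: (@rotE0 _ _ ltB (fun e j => gact (gnB e j))). Qed.

Lemma beta_fix x w : (forall i j, i < N -> j < n -> x <> V i j) ->
  beta (x, w) = (x, w).
Proof.
move=> xP; apply: rot_fun_fix => /in_rotP[i [j [v [iN jn [xE _]]]]].
exact: (xP i j).
Qed.

Lemma alpha_fix x w : (forall e j, e < N + 3 * t -> j < m -> x <> ltA e j) ->
  alpha (x, w) = (x, w).
Proof.
move=> xP; apply: rot_fun_fix => /in_rotP[i [j [v [iN jn [xE _]]]]].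
exact: (xP i j).
Qed.

Lemma alpha_order : has_order alpha m.
Proof. by apply: rot_has_order => [_ _|]; [exact: false|lia]. Qed.

Lemma beta_order : has_order beta n.
Proof. by apply: rot_has_order => [_ _|]; [exact: false|lia]. Qed.

Lemma alpha_cont : cont alpha.
Proof. exact: (rot_fun_cont gnA ltA_inj). Qed.

Lemma beta_cont : cont beta.
Proof. exact: (rot_fun_cont gnB ltB_inj). Qed.

Lemma blkA_poly e j w : e < N -> blkA e j w = (ltA e j, w).
Proof. by move=> eN; rewrite /rot_block /gnA leqNgt ltn_addr. Qed.

Lemma blkA_chord b j w : b < 2 * t ->
  blkA (N + b) j w = (match j with
    | 0 => V (3 * b) 2 | 1 => V (3 * b + 2) 2 | k.+2 => Q b k end, w).
Proof.
move=> bt; rewrite /rot_block /gnA leqNgt ltn_add2l bt /= /ltA ltn_add2l bt.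
by rewrite ltnNge leq_addr /= addKn.
Qed.

Lemma blkA_link k j w : k < t ->
  blkA (N + 2 * t + k) j w = match j with
    | 0 => (V (6 * k + 1) 2, w)
    | 1 => (V (6 * k + 4) 2, gact (nth (Nop H) lk k) w)
    | j.+2 => (Z k j, w) end.
Proof.
move=> kt; rewrite /rot_block /gnA leq_addr /= /ltA.
have -> : (N + 2 * t + k < N) = false by lia.
have -> : (N + 2 * t + k < N + 2 * t) = false by lia.
have -> : N + 2 * t + k - N - 2 * t = k by lia.
by case: j => [|[|j]].
Qed.

Lemma alpha_r i w : i.+1 < N -> alpha (V i 1, w) = (V i.+1 0, w).
Proof.
move=> iN; have := @alpha_next i.+1 0 w (ltn_addr _ iN) m_ge2.
by rewrite !blkA_poly // /ltA iN.
Qed.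

Lemma alpha_rlast w : alpha (V N.-1 2, w) = (V 0 0, w).
Proof.
have N0 : 0 < N by lia.
have := @alpha_next 0 0 w (ltn_addr _ N0) m_ge2.
by rewrite !blkA_poly // /ltA N0.
Qed.

Lemma alpha_l i w : i < N -> 2 < m -> alpha (V i 0, w) = (V i n, w).
Proof.
move=> iN m2; have := @alpha_next i 1 w (ltn_addr _ iN) m2.
by rewrite !blkA_poly // /ltA iN addn0.
Qed.

Lemma alpha_l2 i w : i < N -> m = 2 -> alpha (V i 0, w) = (rP i, w).
Proof.
move=> iN m2; have := @alpha_last i w (ltn_addr _ iN).
by rewrite !blkA_poly // m2 /ltA iN.
Qed.

Lemma alpha_f i j w : i < N -> j.+3 < m -> alpha (V i (n + j), w) = (V i (n + j.+1), w).
Proof.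
move=> iN jm; have := @alpha_next i j.+2 w (ltn_addr _ iN) jm.
by rewrite !blkA_poly // /ltA iN.
Qed.

Lemma alpha_flast i w : i < N -> 2 < m -> alpha (V i (n + (m - 3)), w) = (rP i, w).
Proof.
move=> iN m2; have := @alpha_last i w (ltn_addr _ iN).
have -> : m.-1 = (m - 3).+2 by lia.
by rewrite !blkA_poly // /ltA iN.
Qed.

Lemma alpha_chord0 b w : b < 2 * t -> alpha (V (3 * b) 2, w) = (V (3 * b + 2) 2, w).
Proof.
move=> bt; have := @alpha_next (N + b) 0 w; rewrite !blkA_chord //.
by apply=> //; lia.
Qed.

Lemma alpha_chord1 b w : b < 2 * t -> 2 < m -> alpha (V (3 * b + 2) 2, w) = (Q b 0, w).
Proof.
move=> bt m2; have := @alpha_next (N + b) 1 w; rewrite !blkA_chord //.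
by apply=> //; lia.
Qed.

Lemma alpha_chord2 b w : b < 2 * t -> m = 2 -> alpha (V (3 * b + 2) 2, w) = (V (3 * b) 2, w).
Proof.
move=> bt m2; have := @alpha_last (N + b) w; rewrite !blkA_chord // m2.
by apply=> //; lia.
Qed.

Lemma alpha_Q b j w : b < 2 * t -> j.+3 < m -> alpha (Q b j, w) = (Q b j.+1, w).
Proof.
move=> bt jm; have := @alpha_next (N + b) j.+2 w; rewrite !blkA_chord //.
by apply=> //; lia.
Qed.

Lemma alpha_Qlast b w : b < 2 * t -> 2 < m -> alpha (Q b (m - 3), w) = (V (3 * b) 2, w).
Proof.
move=> bt m2; have := @alpha_last (N + b) w.
have -> : m.-1 = (m - 3).+2 by lia.
by rewrite !blkA_chord //; apply=> //; lia.
Qed.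

Local Notation M k := (gact (nth (Nop H) lk k)).

Lemma alpha_link0 k w : k < t -> alpha (V (6 * k + 1) 2, w) = (V (6 * k + 4) 2, M k w).
Proof.
move=> kt; have := @alpha_next (N + 2 * t + k) 0 w; rewrite !blkA_link //.
by apply=> //; lia.
Qed.

Lemma alpha_link1 k w : k < t -> 2 < m -> alpha (V (6 * k + 4) 2, M k w) = (Z k 0, w).
Proof.
move=> kt m2; have := @alpha_next (N + 2 * t + k) 1 w; rewrite !blkA_link //.
by apply=> //; lia.
Qed.

Lemma alpha_link2 k w : k < t -> m = 2 ->
  alpha (V (6 * k + 4) 2, M k w) = (V (6 * k + 1) 2, w).
Proof.
move=> kt m2; have := @alpha_last (N + 2 * t + k) w.
by rewrite !blkA_link // m2; apply=> //; lia.
Qed.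

Lemma alpha_Z k j w : k < t -> j.+3 < m -> alpha (Z k j, w) = (Z k j.+1, w).
Proof.
move=> kt jm; have := @alpha_next (N + 2 * t + k) j.+2 w; rewrite !blkA_link //.
by apply=> //; lia.
Qed.

Lemma alpha_Zlast k w : k < t -> 2 < m -> alpha (Z k (m - 3), w) = (V (6 * k + 1) 2, w).
Proof.
move=> kt m2; have := @alpha_last (N + 2 * t + k) w.
have -> : m.-1 = (m - 3).+2 by lia.
by rewrite !blkA_link //; apply=> //; lia.
Qed.

(** The second brick of a link is only the image of the label, and no other cycle of alpha meets its
    letter. *)
Lemma alpha_linkfix k w : k < t -> (forall v, w <> M k v) ->
  alpha (V (6 * k + 4) 2, w) = (V (6 * k + 4) 2, w).
Proof.
move=> kt wM; apply: rot_fun_fix => /in_rotP[e [j [v [le jm yE]]]].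
have ek : e = N + 2 * t + k /\ j = 1.
  apply: ltA_inj => //; [lia|].
  case: yE => <- _; rewrite /ltA.
  have -> : (N + 2 * t + k < N) = false by lia.
  have -> : (N + 2 * t + k < N + 2 * t) = false by lia.
  by congr V; lia.
move: yE; rewrite ek.1 ek.2 blkA_link // => -[]; exact: wM.
Qed.

Lemma alpha_fixV i j w :
  i < N -> (2 < j < n) || (j == 2) && (6 * t <= i < N.-1) || (j == 1) && (i == N.-1) ->
  alpha (V i j, w) = (V i j, w).
Proof.
move=> iN ij; apply: alpha_fix => e k le km; rewrite /ltA /rP.
by case: k km => [|[|k]] km; do ![case: ifP => ?]; first [done | case; lia | lia].
Qed.


(** * Faces: the orbits of alpha beta on letters *)

Local Notation gamma := (fun y => alpha (beta y)).
Local Notation "x --{ k }-> y" := (iter k gamma x = y) (at level 70).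

Lemma steps_trans k l x y z : x --{k}-> y -> y --{l}-> z -> x --{k + l}-> z.
Proof. by move=> <- <-; rewrite addnC iterD. Qed.

Lemma step1 x y : alpha (beta x) = y -> x --{1}-> y.
Proof. by []. Qed.

Lemma beta_f i j w : n <= j -> beta (V i j, w) = (V i j, w).
Proof. by move=> nj; apply: beta_fix => i' j' _ jn' [_]; lia. Qed.

Lemma steps_leg i j w : i < N -> 2 <= j < n -> (V i 2, w) --{j - 2}-> (V i j, w).
Proof.
move=> iN; case: j => [|[|j]] // /andP[_]; rewrite subSS subSS subn0.
elim: j => // j IH jn; rewrite iterS IH; last exact: ltnW.
by rewrite beta_next // alpha_fixV //; lia.
Qed.

Lemma steps_f i j w : i < N -> j < m - 2 -> (V i 2, w) --{n - 2 + j}-> (V i (n + j), w).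
Proof.
move=> iN; elim: j => [|j IH] jm.
  have -> : n - 2 + 0 = n.-1 - 2 + 1 by lia.
  apply: steps_trans (_ : _ --{_}-> (V i n.-1, w)) _; first by apply: steps_leg => //; lia.
  by apply: step1; rewrite beta_last // alpha_l ?addn0 //; lia.
have -> : n - 2 + j.+1 = n - 2 + j + 1 by lia.
apply: steps_trans (IH (ltnW jm)) _; apply: step1.
by rewrite beta_f ?leq_addr // alpha_f //; lia.
Qed.

Lemma steps_r i w : i < N -> (V i 2, w) --{K.-1}-> (rP i, w).
Proof.
move=> iN; have [m2|m2] : m = 2 \/ 2 < m by lia.
  have -> : K.-1 = n.-1 - 2 + 1 by lia.
  apply: steps_trans (_ : _ --{_}-> (V i n.-1, w)) _; first by apply: steps_leg => //; lia.
  by apply: step1; rewrite beta_last // alpha_l2.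
have -> : K.-1 = n - 2 + (m - 3) + 1 by lia.
apply: steps_trans (_ : _ --{_}-> (V i (n + (m - 3)), w)) _.
  by apply: steps_f => //; lia.
by apply: step1; rewrite beta_f ?leq_addr // alpha_flast.
Qed.

(** [K] counts the letters from leg 2 of the vertex i + 1 through its remaining legs and along the
    edge i + 1; beta then turns to leg 2 of the vertex i, where it depends on chords and links what
    alpha does. *)
Lemma steps_next i w : i.+1 < N -> (V i.+1 2, w) --{K}-> alpha (V i 2, w).
Proof.
move=> iN; have -> : K = K.-1 + 1 by lia.
apply: steps_trans (steps_r _ iN) _; apply: step1.
by rewrite [rP _](_ : _ = V i 1) // beta_next //; lia.
Qed.

Lemma steps_zero w : (V 0 2, w) --{K.-1}-> (V N.-1 2, w).
Proof. by rewrite steps_r //; lia. Qed.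

Lemma beta_Q b j w : beta (Q b j, w) = (Q b j, w).
Proof. exact: beta_fix. Qed.

Lemma beta_Z k j w : beta (Z k j, w) = (Z k j, w).
Proof. exact: beta_fix. Qed.

Lemma steps_Q b j w : b < 2 * t -> j < m - 2 ->
  alpha (V (3 * b + 2) 2, w) --{j}-> (Q b j, w).
Proof.
move=> bt; elim: j => [|j IH] jm; first by apply: alpha_chord1 => //; lia.
by rewrite iterS IH ?beta_Q ?alpha_Q //; lia.
Qed.

Lemma steps_chord b w : b < 2 * t ->
  alpha (V (3 * b + 2) 2, w) --{m - 2}-> (V (3 * b) 2, w).
Proof.
move=> bt; have [m2|m2] : m = 2 \/ 2 < m by lia.
  by rewrite alpha_chord2 // m2.
rewrite {1}(_ : m - 2 = m - 3 + 1); last lia.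
apply: steps_trans (_ : _ --{_}-> (Q b (m - 3), w)) _; first by apply: steps_Q => //; lia.
by apply: step1; rewrite beta_Q alpha_Qlast.
Qed.

Lemma steps_Z k j w : k < t -> j < m - 2 ->
  alpha (V (6 * k + 4) 2, M k w) --{j}-> (Z k j, w).
Proof.
move=> kt; elim: j => [|j IH] jm; first by apply: alpha_link1 => //; lia.
by rewrite iterS IH ?beta_Z ?alpha_Z //; lia.
Qed.

Lemma steps_link k w : k < t ->
  alpha (V (6 * k + 4) 2, M k w) --{m - 2}-> (V (6 * k + 1) 2, w).
Proof.
move=> kt; have [m2|m2] : m = 2 \/ 2 < m by lia.
  by rewrite alpha_link2 // m2.
rewrite {1}(_ : m - 2 = m - 3 + 1); last lia.
apply: steps_trans (_ : _ --{_}-> (Z k (m - 3), w)) _; first by apply: steps_Z => //; lia.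
by apply: step1; rewrite beta_Z alpha_Zlast.
Qed.

(* The block b contains a face of length 2K through its middle leg. *)
Lemma steps_lo b w : b < 2 * t -> (V (3 * b + 1) 2, w) --{K}-> (V (3 * b + 2) 2, w).
Proof.
move=> bt; rewrite -(alpha_chord0 _ bt) addn1; apply: steps_next; lia.
Qed.

Lemma steps_hi b w : b < 2 * t -> (V (3 * b + 2) 2, w) --{K}-> alpha (V (3 * b + 1) 2, w).
Proof. by move=> bt; rewrite addn2 addn1; apply: steps_next; lia. Qed.

Lemma steps_block b w : b < 2 * t ->
  (V (3 * b + 1) 2, w) --{2 * K}-> alpha (V (3 * b + 1) 2, w).
Proof.
by move=> bt; rewrite mul2n -addnn; apply: steps_trans (steps_lo w bt) (steps_hi w bt).
Qed.

Lemma block_even k : 6 * k + 1 = 3 * (2 * k) + 1. Proof. lia. Qed.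
Lemma block_odd k : 6 * k + 4 = 3 * (2 * k).+1 + 1. Proof. lia. Qed.

(** The link merges the faces of the blocks 2k and 2k + 1. The label is applied on entering the
    second block and undone on leaving it, so the orbit closes up whatever the order of the
    label. *)
Lemma steps_linked k w : k < t ->
  (V (6 * k + 1) 2, w) --{4 * K + (m - 2)}-> (V (6 * k + 1) 2, w).
Proof.
move=> kt; have -> : 4 * K + (m - 2) = 2 * K + (2 * K + (m - 2)) by lia.
apply: steps_trans (_ : _ --{_}-> (V (6 * k + 4) 2, M k w)) _.
  rewrite {1}block_even steps_block; last lia.
  by rewrite -block_even alpha_link0.
apply: steps_trans (steps_link w kt); rewrite {1}block_odd steps_block; last lia.
by rewrite -block_odd.
Qed.

Lemma steps_unlinked k w : k < t -> (forall v, w <> M k v) ->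
  (V (6 * k + 4) 2, w) --{2 * K}-> (V (6 * k + 4) 2, w).
Proof.
move=> kt wM; rewrite {1}block_odd steps_block; last lia.
by rewrite -block_odd alpha_linkfix.
Qed.

Lemma steps_plain i w : 6 * t <= i < N ->
  (V N.-1 2, w) --{(N.-1 - i) * K}-> (V i 2, w).
Proof.
have steps d : d <= N.-1 - 6 * t -> (V N.-1 2, w) --{d * K}-> (V (N.-1 - d) 2, w).
  elim: d => [|d IH] dN; first by rewrite subn0.
  rewrite mulSn addnC; apply: steps_trans (IH (ltnW dN)) _.
  have -> : N.-1 - d = (N.-1 - d.+1).+1 by lia.
  by rewrite steps_next ?alpha_fixV //; lia.
move=> /andP[ti iN]; rewrite steps; last lia.
by rewrite subKn //; lia.
Qed.

(** The chord carries the outer face from one end of the block to the other, past the middle leg. *)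
Lemma steps_skip b w : b < 2 * t -> (V (3 * b.+1) 2, w) --{K + (m - 2)}-> (V (3 * b) 2, w).
Proof.
move=> bt; apply: steps_trans (steps_chord w bt).
have -> : 3 * b.+1 = (3 * b + 2).+1 by lia.
by rewrite steps_next //; lia.
Qed.

Lemma steps_skips b w : b <= 2 * t ->
  (V (6 * t) 2, w) --{(2 * t - b) * (K + (m - 2))}-> (V (3 * b) 2, w).
Proof.
have steps d : d <= 2 * t ->
    (V (6 * t) 2, w) --{d * (K + (m - 2))}-> (V (3 * (2 * t - d)) 2, w).
  elim: d => [|d IH] dt; first by rewrite subn0 mulnA.
  rewrite mulSn addnC; apply: steps_trans (IH (ltnW dt)) _.
  have -> : 2 * t - d = (2 * t - d.+1).+1 by lia.
  by apply: steps_skip; lia.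
by move=> bt; rewrite steps ?subKn // leq_subr.
Qed.

(** The summands stand for the plain vertices, for the 2t blocks skipped along their chords, and for
    the edge 0. The last is one step shorter, since it ends at leg 2 of the reversed vertex
    itself. *)
Definition outer_length := (N.-1 - 6 * t) * K + 2 * t * (K + (m - 2)) + K.-1.

Lemma steps_outer w : (V N.-1 2, w) --{outer_length}-> (V N.-1 2, w).
Proof.
rewrite /outer_length -addnA; apply: steps_trans (steps_plain _ _) _; first lia.
apply: steps_trans (steps_zero w).
by have := steps_skips w (leq0n _); rewrite subn0 muln0.
Qed.

(** A common multiple of the lengths of all faces but the prime one: the outer face, a block left
    alone by its link, and two linked blocks. *)
Definition period := outer_length * (2 * K) * (4 * K + (m - 2)).

Definition periodic y := y --{period}-> y.

Lemma periodic_dvd d y : d %| period -> y --{d}-> y -> periodic y.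
Proof.
move=> /dvdnP[e pE] yd; rewrite /periodic pE.
by elim: e {pE} => // e IH; rewrite mulSn; exact: steps_trans yd IH.
Qed.

Lemma periodic_steps k x y : x --{k}-> y -> periodic x -> periodic y.
Proof. by move=> <- px; rewrite /periodic -iterD addnC iterD px. Qed.

Lemma periodic_last w : periodic (V N.-1 2, w).
Proof.
apply: periodic_dvd (steps_outer w); rewrite /period -mulnA; exact: dvdn_mulr.
Qed.

Lemma periodic_leg i w : i < N -> periodic (V i 2, w).
Proof.
move=> iN; have [ti|ti] := leqP (6 * t) i.
  by apply: periodic_steps (steps_plain w _) (periodic_last w); rewrite ti.
have b_lt : i %/ 3 < 2 * t by lia.
have iE := divn_eq i 3; have : i %% 3 < 3 by rewrite ltn_mod.
rewrite [i in V i]iE mulnC; move: (i %/ 3) (i %% 3) b_lt => b r bt.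
have mid v : periodic (V (3 * b + 1) 2, v).
  have [k [kt [->|->]]] : exists k, k < t /\ (b = 2 * k \/ b = (2 * k).+1).
    by exists (b./2); lia.
    rewrite -block_even; apply: periodic_dvd (steps_linked v kt).
    exact: dvdn_mull.
  (* In the second block of a link the face depends on the stream: in the image of the label it is
     the merged face, elsewhere that of the block alone. *)
  rewrite -block_odd; have [[u ->]|nu] := pselect (exists u, v = M k u).
    apply: (@periodic_steps (2 * K) (V (6 * k + 1) 2, u)); last first.
      by apply: periodic_dvd (steps_linked u kt); exact: dvdn_mull.
    rewrite {1}block_even steps_block; last lia.
    by rewrite -block_even alpha_link0.
  have uM u : v <> M k u by move=> uv; apply: nu; exists u.
  apply: periodic_dvd (steps_unlinked kt uM).
  rewrite /period -mulnA; exact/dvdn_mull/dvdn_mulr.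
case: r => [|[|[|]]] // _; last by apply: periodic_steps (steps_lo w bt) (mid w).
rewrite addn0; apply: periodic_steps (steps_skips w (ltnW bt)) _.
by apply: periodic_steps (steps_plain w _) (periodic_last w); lia.
Qed.

(* On these letters gamma is a cycle of prime length N + 1. *)
Definition face a := if a < N then V a 0 else V N.-1 1.

Definition in_face x := exists2 a, a <= N & x = face a.

(** The type [letter] is infinite; these finitely many letters are those that alpha and beta act on,
    and both fix all others. *)
Definition live x := match x with
  | V i j => (i < N) && (j < m + n - 2)
  | Q b j => (b < 2 * t) && (j < m - 2)
  | Z k j => (k < t) && (j < m - 2) end.

(** Each of these letters is reached by alpha beta from leg 2 of some vertex. *)
Lemma periodic_live x w : live x -> ~ in_face x -> periodic (x, w).
Proof.
case: x => [i j|b j|k j] /andP[iN jm] nf.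
- case: j jm nf => [|[|j]] jm nf.
  + by case: nf; exists i; rewrite 1?ltnW // /face iN.
  + have [iN1|iN1] := eqVneq i N.-1.
      by case: nf; exists N; rewrite // /face ltnn iN1.
    have iN2 : i.+1 < N by lia.
    by apply: periodic_steps (steps_r w iN2) (periodic_leg _ _).
  + have [jn|jn] := ltnP j.+2 n.
      by apply: periodic_steps (steps_leg w iN _) (periodic_leg _ iN).
    rewrite {1}(_ : j.+2 = n + (j.+2 - n)); last lia.
    by apply: periodic_steps (steps_f w iN _) (periodic_leg _ iN); lia.
- apply: periodic_steps (steps_Q w iN jm) _.
  have i3 : (3 * b + 2).+1 < N by lia.
  exact: periodic_steps (steps_next w i3) (periodic_leg _ i3).
- apply: periodic_steps (steps_Z w iN jm) _.
  have i3 : (6 * k + 4).+1 < N by lia.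
  exact: periodic_steps (steps_next _ i3) (periodic_leg _ i3).
Qed.

Lemma live_ltA e j : e < N + 3 * t -> j < m -> live (ltA e j).
Proof.
move=> le jm; rewrite /ltA /rP.
by case: j jm => [|[|j]] jm; do ![case: ifP => ?] => /=; lia.
Qed.

Lemma alpha_dead x w : ~~ live x -> alpha (x, w) = (x, w).
Proof.
move=> dx; apply: alpha_fix => e j le jm xE; move: dx.
by rewrite xE live_ltA.
Qed.

Lemma beta_dead x w : ~~ live x -> beta (x, w) = (x, w).
Proof. by move=> dx; apply: beta_fix => i j iN jn xE; move: dx; rewrite xE /=; lia. Qed.

Lemma periodic_out x w : ~ in_face x -> periodic (x, w).
Proof.
have [lx|dx] := boolP (live x); first exact: periodic_live.
move=> _; rewrite /periodic; elim: period => // k IH.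
by rewrite iterS IH beta_dead // alpha_dead.
Qed.

(** The face has one letter at each vertex except the reversed one, which contributes its letters 0
    and 1; hence the length N + 1. *)
Lemma step_face a w : a <= N -> alpha (beta (face a, w)) = (face (a.+1 %% N.+1), w).
Proof.
move=> aN; rewrite /face; case: (ltngtP a N) aN => // [aN _|-> _].
  rewrite modn_small ?ltnS // beta_next //; last lia.
  have [aN1|aN1] := ltnP a.+1 N; first by rewrite alpha_r.
  have -> : a = N.-1 by lia.
  by rewrite alpha_fixV //; lia.
rewrite modnn beta_next; [|lia|lia]; rewrite alpha_rlast.
by have -> : 0 < N by lia.
Qed.

Lemma steps_face k a w : a <= N -> (face a, w) --{k}-> (face ((a + k) %% N.+1), w).
Proof.
move=> aN; elim: k => [|k IH]; first by rewrite addn0 modn_small.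
rewrite iterS IH step_face; last by rewrite -ltnS ltn_mod.
by rewrite -addn1 modnDml addn1 addnS.
Qed.

(** The prime N + 1 exceeds the factors 2, K and 4K + m - 2, so only the length of the outer face
    takes an argument. *)
Lemma period_coprime : prime N.+1 -> (1 + 4 * t) * K + 1 < N ->
  4 * K + m < N -> coprime period N.+1.
Proof.
move=> Np N1 N2; rewrite coprime_sym prime_coprime // /period !Euclid_dvdM //.
have nd d : 0 < d < N.+1 -> (N.+1 %| d) = false.
  by move=> /andP[d0 dN]; apply/negbTE; rewrite gtnNdvd.
rewrite (nd 2) ?(nd K) ?(nd (4 * K + (m - 2))) ?orbF; try lia.
(* modulo N + 1 the length of the outer face is -B, and 0 < B < N + 1 *)
pose B := (1 + 4 * t) * K + 1 - 2 * t * (m - 2).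
have mK : 2 * t * (m - 2) <= 4 * t * K by rewrite leq_mul //; lia.
have LB : outer_length + B = N.+1 * K.
  have [k kE] : exists k, N = 6 * t + k.+1 by exists (N - 6 * t).-1; lia.
  have [l lE] : exists l, K = l.+1 by exists K.-1; lia.
  rewrite /outer_length /B; rewrite !lE in mK *.
  have -> : N.-1 - 6 * t = k by lia.
  rewrite kE /=; move: (m - 2) mK => d mK; nia.
apply/negP => dL; have : N.+1 %| outer_length + B by rewrite LB dvdn_mulr.
by rewrite dvdn_addr // nd //; rewrite /B; nia.
Qed.

End Generators.

(** * The group generated by alpha and beta *)

Section BigGroup.
Variables (H : groupType) (m n N : nat) (lk : seq (gen H)).
Local Notation W := (stream H).
Local Notation Y := (letter * W)%type.
Local Notation t := (size lk).
Local Notation K := (m + n - 3).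
Hypothesis m_ge2 : 2 <= m.
Hypothesis n_ge3 : 3 <= n.
Hypothesis N_large : 6 * t + 10 <= N.
Hypothesis N_prime : prime N.+1.
Hypothesis N_large1 : (1 + 4 * t) * K + 1 < N.
Hypothesis N_large2 : 4 * K + m < N.

Local Notation al := (alpha m_ge2 n_ge3 N_large).
Local Notation be := (beta m_ge2 n_ge3 N_large).
Local Notation lv := (live m n N lk).

Definition big_group : set (sym Y) := generated_subgroup [set` [:: al; be]].
Local Notation P := big_group.

Lemma big_group1 : P 1%g.
Proof. by have [+ _] := generated_subgroup_closed [set` [:: al; be]]; rewrite in_setE. Qed.

Lemma big_groupM x y : P x -> P y -> P (x * y)%g.
Proof.
have := group_closedM (generated_subgroup_closed [set` [:: al; be]]).
by move=> PM Px Py; have := PM x y; rewrite !in_setE; exact.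
Qed.

Lemma big_groupV x : P x -> P x^-1%g.
Proof.
have := group_closedV (generated_subgroup_closed [set` [:: al; be]]).
by move=> PV Px; have := PV x; rewrite !in_setE; exact.
Qed.

Lemma big_groupX x k : P x -> P (x ^+ k)%g.
Proof.
move=> Px; elim: k => [|k IH]; first exact: big_group1.
by rewrite expgS; exact: big_groupM.
Qed.

Lemma big_groupJ p x : P p -> P x -> P (p * x * p^-1)%g.
Proof. by move=> Pp Px; apply: big_groupM (big_groupV Pp); exact: big_groupM. Qed.

Lemma big_group_al : P al.
Proof. by apply: sub_generated_subgroup => /=; rewrite inE eqxx. Qed.

Lemma big_group_be : P be.
Proof. by apply: sub_generated_subgroup => /=; rewrite !inE eqxx orbT. Qed.

Lemma big_group_ind (C : sym Y -> Prop) : C 1%g ->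
  (forall x y, C x -> C y -> C (x * y)%g) -> (forall x, C x -> C x^-1%g) ->
  C al -> C be -> forall g, P g -> C g.
Proof.
move=> C1 CM CV Ca Cb g Pg; have := Pg [set x | C x]%classic; apply; split.
  split; first by rewrite in_setE.
  by move=> x y; rewrite !in_setE /= => Cx /CV; exact: CM.
by move=> x /=; rewrite !inE => /orP[] /eqP ->.
Qed.

(** Take the power of alpha beta with exponent e * [period], where e inverts [period] modulo N + 1:
    it is a single step on the prime face and trivial elsewhere. *)
Lemma face_cycle : exists c, [/\ P c,
  forall a w, a <= N -> c (face N a, w) = (face N (a.+1 %% N.+1), w) &
  forall x w, ~ in_face N x -> c (x, w) = (x, w)].
Proof.
have pc := period_coprime m_ge2 n_ge3 N_large N_prime N_large1 N_large2.
have p_gt0 : 0 < period m n N lk.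
  rewrite lt0n; apply: contraTneq pc => ->.
  by rewrite /coprime gcd0n; lia.
have /(coprimeP _ p_gt0)[[e d] /= ed] := pc.
exists ((al * be) ^+ (e * period m n N lk))%g; split.
- apply: big_groupX; apply: big_groupM; [exact: big_group_al|exact: big_group_be].
- move=> a w aN; rewrite symXE.
  rewrite [LHS](steps_face m_ge2 n_ge3 N_large _ _ aN).
  have -> : e * period m n N lk = 1 + d * N.+1 by lia.
  by rewrite addnA addn1 [_ + d * _]addnC modnMDl.
- move=> x w nx; rewrite symXE.
  have := periodic_out m_ge2 n_ge3 N_large w nx; rewrite /periodic => pE.
  elim: e {ed} => // e IH; rewrite mulSn iterD IH; exact: pE.
Qed.

(** * Three-cycles of letters *)

Local Notation t3 := (fun x y z : letter =>
  has3 P (@pair letter W x) (@pair letter W y) (@pair letter W z)).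

Lemma faceV i : i < N -> face N i = V i 0.
Proof. by rewrite /face => ->. Qed.

Lemma faceN : face N N = V N.-1 1.
Proof. by rewrite /face ltnn. Qed.

Lemma not_face_V i j : i < N -> (1 < j) || (j == 1) && (i < N.-1) -> ~ in_face N (V i j).
Proof. by move=> iN ij [a aN]; rewrite /face; case: ifP => _; case; lia. Qed.

(* Because of the reversed vertex, the supports of c and of its conjugate by beta
   meet in a single letter. *)
Lemma t3_base : t3 (V N.-1 1) (V 0 0) (V N.-1 2).
Proof.
have [c [Pc cf cx]] := face_cycle.
(* The support of c consists of the letters V i 0 and V (N - 1) 1, that of c' of the letters V i 1
   and V (N - 1) 2. *)
pose c' := (be * c * be^-1)%g.
have Pc' : P c' by apply: big_groupJ => //; exact: big_group_be.
have cl i w : i.+1 < N -> c (V i 0, w) = (V i.+1 0, w).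
  by move=> iN; rewrite -!faceV ?cf ?modn_small //; lia.
have cN w : c (V N.-1 0, w) = (V N.-1 1, w).
  rewrite -faceN -faceV; last lia.
  rewrite cf ?prednK ?modn_small //; lia.
have cu w : c (V N.-1 1, w) = (V 0 0, w).
  by rewrite -faceN cf // modnn faceV //; lia.
have cV i j w : i < N -> (1 < j) || (j == 1) && (i < N.-1) -> c (V i j, w) = (V i j, w).
  by move=> iN ij; apply/cx/not_face_V.
have beV i j w : i < N -> j.+1 < n -> (be^-1)%g (V i j.+1, w) = (V i j, w).
  by move=> iN jn; apply: sym_eqV; rewrite beta_next.
have beV0 i w : i < N -> (be^-1)%g (V i 0, w) = (V i n.-1, w).
  by move=> iN; apply: sym_eqV; rewrite beta_last.
have c'l i w : i < N -> c' (V i 0, w) = (V i 0, w).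
  by move=> iN; rewrite !symME beV0 // cV ?beta_last //; lia.
have c'u w : c' (V N.-1 1, w) = (V N.-1 2, w).
  by rewrite !symME beV ?cN ?beta_next //; lia.
have c'r w : c' (V N.-2 1, w) = (V N.-1 1, w).
  rewrite !symME beV ?cl ?beta_next //; try lia.
  by congr (V _ _, _); lia.
exists (c * c' * c^-1 * c'^-1)%g.
  by apply: big_groupM; [exact: big_groupJ|exact: big_groupV].
have c3 : is3 (c * c' * c^-1 * c'^-1)%g (pair (V N.-1 1))
    (c \o pair (V N.-1 1)) (c' \o pair (V N.-1 1)).
  apply: is3_commutator => [w|w|w|w|[x w] xu].
  - by rewrite cu c'l //; lia.
  - by rewrite c'u cV //; lia.
  - by rewrite (sym_eqV (cN w)) c'l //; lia.
  - by rewrite (sym_eqV (c'r w)) cV //; lia.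
  have [[a aN xE]|nx] := pselect (in_face N x); last by left; exact: cx.
  right; rewrite xE; have [aN1|aN1] := ltnP a N; first by rewrite faceV // c'l.
  have aE : a = N by lia.
  by case: (xu w); rewrite xE aE faceN.
by apply: is3_ext c3 => // w; rewrite /comp ?cu ?c'u.
Qed.


Lemma t3_rot x y z : t3 x y z -> t3 y z x.
Proof. exact: has3_rot. Qed.

Lemma t3_swap x y z : t3 x y z -> t3 y x z.
Proof. by move=> h; do 2 apply: has3_rot; apply: has3_rev h; exact: big_groupV. Qed.

(** Conjugate the 3-cycle (x y a) by (x y b). *)
Lemma t3_move x y a b : t3 x y a -> t3 x y b ->
  a != x -> a != y -> a != b -> t3 y b a.
Proof.
move=> ta [p Pp [xy yb _ fx]] ax ay ab.
apply: (has3_conj big_groupJ Pp _ _ _ ta) => w //.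
by apply: fx => v [] /eqP; rewrite ?(negbTE ax) ?(negbTE ay) ?(negbTE ab).
Qed.

Definition reachable x0 y0 z := [\/ z = x0, z = y0 | t3 x0 y0 z].

(** As for alternating groups, the 3-cycles through two fixed letters give all others; the cases
    record which of x, y, z is one of the fixed letters. *)
Lemma reachable_t3 x0 y0 x y z : x0 != y0 ->
  reachable x0 y0 x -> reachable x0 y0 y -> reachable x0 y0 z ->
  x != y -> y != z -> x != z -> t3 x y z.
Proof.
move=> xy0; pose R := reachable x0 y0; rewrite -!/(R _).
have A1 a : R a -> a != x0 -> a != y0 -> t3 x0 y0 a.
  by case=> // ->; rewrite eqxx.
have A2 a b : R a -> R b -> a != x0 -> a != y0 -> b != x0 ->
    b != y0 -> a != b -> t3 y0 a b /\ t3 x0 a b.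
  move=> ra rb ax ay bx by' ab; have ta := A1 a ra ax ay; have tb := A1 b rb bx by'.
  have ba : b != a by rewrite eq_sym.
  by split; [exact: t3_move tb ta _ _ _|exact: t3_move (t3_swap tb) (t3_swap ta) _ _ _].
move=> rx ry rz xy yz xz.
have [xE|xx] := eqVneq x x0; have [xE'|xx'] := eqVneq x y0;
have [yE|yx] := eqVneq y x0; have [yE'|yx'] := eqVneq y y0;
have [zE|zx] := eqVneq z x0; have [zE'|zx'] := eqVneq z y0;
subst; rewrite ?eqxx // in xy yz xz xy0 *.
- exact: A1.
- exact/t3_swap/t3_rot/t3_rot/A1.
- by have [] := A2 _ _ ry rz yx yx' zx zx' yz.
- exact/t3_swap/A1.
- by apply: t3_rot; exact: A1.
- by have [] := A2 _ _ ry rz yx yx' zx zx' yz.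
- by apply/t3_rot/t3_rot; exact: A1.
- by apply: t3_swap; have [] := A2 _ _ rx rz xx xx' zx zx' xz.
- exact/t3_swap/t3_rot/A1.
- by apply: t3_swap; have [] := A2 _ _ rx rz xx xx' zx zx' xz.
- by apply: t3_rot; have [] := A2 _ _ rx ry xx xx' yx yx' xy.
- by apply: t3_rot; have [] := A2 _ _ rx ry xx xx' yx yx' xy.
- have [tz _] := A2 _ _ rx rz xx xx' zx zx' xz.
  have [ty _] := A2 _ _ rx ry xx xx' yx yx' xy.
  by apply: t3_move tz ty _ _ _ => //; rewrite eq_sym.
Qed.

(** The letters x and y are exchanged for x0 and y0 one at a time, by [t3_move]. *)
Lemma reachable_close x0 y0 x y z : x0 != y0 ->
  reachable x0 y0 x -> reachable x0 y0 y -> x != y -> t3 x y z -> reachable x0 y0 z.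
Proof.
move=> xy0 rx ry xy tz; pose R := reachable x0 y0; rewrite -!/(R _) in rx ry *.
have rx0 : R x0 by exact: Or31.
have ry0 : R y0 by exact: Or32.
(* While z is not known to be reachable it differs from every reachable letter, as the exchanges
   require. *)
have [nR|] := pselect (~ R z); last by move/contrapT.
have zn a : R a -> z != a by move=> ra; apply/eqP => za; apply: nR; rewrite za.
have next a b c : R a -> R b -> R c -> a != b -> c != a -> c != b ->
    t3 a b z -> t3 b c z.
  move=> ra rb rc ab ca cb tab.
  apply: t3_move tab _ (zn a ra) (zn b rb) (zn c rc).
  by apply: (@reachable_t3 x0 y0) => //; rewrite eq_sym.
have yx0 : y0 != x0 by rewrite eq_sym.
apply: Or33; have [xE|xx] := eqVneq x x0.
  subst x; have [<- //|yy] := eqVneq y y0.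
  by apply: (next y) => //; first [exact: t3_swap|by rewrite eq_sym].
have [yE|yx] := eqVneq y x0.
  subst y; have [xE|xy'] := eqVneq x y0; first by subst x; exact: t3_swap.
  by apply: (next x) => //; rewrite eq_sym.
have [xE|xy'] := eqVneq x y0.
  by subst x; apply: t3_swap; apply: (next y) => //; first [exact: t3_swap|by rewrite eq_sym].
have [yE|yy] := eqVneq y y0.
  by subst y; apply: t3_swap; apply: (next x) => //; rewrite eq_sym.
apply: (next y) => //; try by rewrite eq_sym.
by apply: (next x) => //; rewrite eq_sym.
Qed.

Let w0 : W := fun _ _ => false.

Lemma reachable_conj p x0 y0 x y z x' y' z' : P p -> x0 != y0 ->
  reachable x0 y0 x -> reachable x0 y0 y -> reachable x0 y0 z ->
  x != y -> y != z -> x != z ->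
  (forall w, p (x, w) = (x', w)) -> (forall w, p (y, w) = (y', w)) ->
  (forall w, p (z, w) = (z', w)) ->
  reachable x0 y0 x' -> reachable x0 y0 y' -> reachable x0 y0 z'.
Proof.
move=> Pp xy0 rx ry rz xy yz xz px py pz rx' ry'.
apply: (reachable_close xy0 rx' ry').
  apply: contra_neq xy => xy'; have : p (x, w0) = p (y, w0) by rewrite px py xy'.
  by move/(@sym_inj _ p) => [].
apply: (has3_conj big_groupJ Pp px py pz).
exact: reachable_t3 xy0 rx ry rz xy yz xz.
Qed.

Lemma live_reachable z : lv z -> reachable (V N.-1 1) (V N.-1 2) z.
Proof.
pose R := reachable (V N.-1 1) (V N.-1 2); rewrite -!/(R _).
have ur : V N.-1 1 != V N.-1 2 by apply/eqP => -[].
have Ru : R (V N.-1 1) by exact: Or31.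
have Rr : R (V N.-1 2) by exact: Or32.
have R0 : R (V 0 0) by apply/Or33/t3_swap/t3_rot/t3_rot/t3_base.
have [c [Pc cf cx]] := face_cycle.
have cr w : c (V N.-1 2, w) = (V N.-1 2, w) by apply/cx/not_face_V => //; lia.
have cl i w : i.+1 < N -> c (V i 0, w) = (V i.+1 0, w).
  by move=> iN; rewrite -!faceV ?cf ?modn_small //; lia.
have cu w : c (V N.-1 1, w) = (V 0 0, w).
  by rewrite -faceN cf // modnn faceV //; lia.
have neqV i j i' j' : (i != i') || (j != j') -> V i j != V i' j'.
  by move=> ij; apply/eqP => -[]; lia.
(* Conjugation by c, which fixes V (N - 1) 2 and takes V (N - 1) 1 to V 0 0. *)
have Rl i : i < N -> R (V i 0).
  elim: i => // i IH iN.
  by apply: (reachable_conj Pc ur Rr Ru (IH (ltnW iN)) _ _ _ cr cu (fun w => cl i w iN)) => //;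
    apply: neqV; lia.
(* Conjugation by beta, which shifts the letters 0 and 1 of the reversed vertex to 1 and 2. *)
have RV i j : i < N -> j < n -> R (V i j).
  move=> iN; elim: j => [|j IH] jn; first exact: Rl.
  have [iE|iE] := boolP ((i == N.-1) && (j <= 1)).
    case/andP: iE => /eqP-> ; case: j {IH} jn => [|[|]] //.
  have N1 : N.-1 < N by lia.
  apply: (reachable_conj big_group_be ur (Rl N.-1 N1) Ru (IH (ltnW jn))
    _ _ _ _ _ (fun w => beta_next _ _ _ w iN jn) Ru Rr).
  - by apply: neqV; lia.
  - by apply: neqV; lia.
  - by apply: neqV; lia.
  - by move=> w; rewrite beta_next //; lia.
  - by move=> w; rewrite beta_next //; lia.
have al_u w : al (V N.-1 1, w) = (V N.-1 1, w) by rewrite alpha_fixV //; lia.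
have al_r w : al (V 0 1, w) = (V 1 0, w) by rewrite alpha_r //; lia.
have R1 : R (V 0 1) by apply: RV; lia.
have R2 : R (V 1 0) by apply: RV; lia.
(* Conjugation by alpha, which fixes V (N - 1) 1 and takes V 0 1 to V 1 0. *)
have step x x' : (forall w, al (x, w) = (x', w)) -> x != x' -> x != V 0 1 -> R x -> R x'.
  move=> xx' nx xr Rx.
  apply: (reachable_conj big_group_al ur Ru R1 Rx _ _ _ al_u al_r xx' Ru R2).
  - by apply: neqV; lia.
  - by rewrite eq_sym.
  - by apply: contra_neq nx => ux; have := xx' w0; rewrite -ux al_u => -[].
have stepV x x' : (forall w, al (x', w) = (x, w)) -> x != x' -> x != V 1 0 -> R x -> R x'.
  move=> xx' nx xr Rx.
  apply: (reachable_conj (big_groupV big_group_al) ur Ru R2 Rx _ _ _ _ _ _ Ru R1).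
  - by apply: neqV; lia.
  - by rewrite eq_sym.
  - apply: contra_neq nx => ux; have := sym_eqV (xx' w0).
    by rewrite -ux sym_fixV ?al_u // => -[].
  - by move=> w; exact/sym_fixV/al_u.
  - by move=> w; exact/sym_eqV/al_r.
  - by move=> w; exact/sym_eqV/xx'.
have Rf i j : i < N -> j < m - 2 -> R (V i (n + j)).
  move=> iN; elim: j => [|j IH] jm.
    apply: (step (V i 0)); [|by apply: neqV; lia|by apply: neqV; lia|exact: Rl].
    by move=> w; rewrite addn0 alpha_l //; lia.
  apply: (step (V i (n + j))); [|by apply: neqV; lia|by apply: neqV; lia|apply: IH; lia].
  by move=> w; rewrite alpha_f //; lia.
case: z => [i j|b j|k j] /= /andP[iN jm].
- have [jn|jn] := ltnP j n; first exact: RV.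
  by rewrite -(subnKC jn); apply: Rf => //; lia.
- elim: j jm => [|j IH] jm.
    apply: (step (V (3 * b + 2) 2)); [|by apply/eqP| |by apply: RV; lia].
      by move=> w; rewrite alpha_chord1 //; lia.
    by apply: neqV; lia.
  apply: (step (Q b j)); [|by apply/eqP => -[]; lia|by apply/eqP|apply: IH; lia].
  by move=> w; rewrite alpha_Q //; lia.
(* Alpha takes to Z k 0 only a brick of its preceding letter, so the letters of a link are reached
   backwards from V (6k + 1) 2. *)
have RZ d : d <= m - 3 -> R (Z k (m - 3 - d)).
  elim: d => [|d IH] dm.
    rewrite subn0; apply: (stepV (V (6 * k + 1) 2)); [|by apply/eqP| |by apply: RV; lia].
      by move=> w; rewrite alpha_Zlast //; lia.
    by apply: neqV; lia.
  apply: (stepV (Z k (m - 3 - d))); [|by apply/eqP => -[]; lia|by apply/eqP|apply: IH; lia].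
  move=> w; rewrite alpha_Z //; last lia.
  by congr (Z _ _, _); lia.
have -> : j = m - 3 - (m - 3 - j) by lia.
by apply: RZ; lia.
Qed.

Lemma live_t3 x y z : lv x -> lv y -> lv z -> x != y -> y != z -> x != z -> t3 x y z.
Proof.
move=> lx ly lz; apply: (@reachable_t3 (V N.-1 1) (V N.-1 2)); try exact: live_reachable.
by apply/eqP => -[].
Qed.

(** * From letters to bricks *)

Definition brick x (f : W -> W) (w : W) : Y := (x, f w).

Lemma disj_brick x y f g : x != y -> disj (brick x f) (brick y g).
Proof. by move=> xy v w /(congr1 fst) /= /eqP; rewrite (negbTE xy). Qed.

Lemma brick_neq x y f w u : x != y -> brick x f w <> (y, u).
Proof. by move=> xy; exact: (@disj_brick x y f (fun=> u) xy w u). Qed.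

Local Ltac neq := first [done | by rewrite eq_sym | apply: brick_neq; first [done | by rewrite eq_sym]].

Lemma fresh (s : seq letter) : size s < 10 -> exists2 x, lv x & x \notin s.
Proof.
move=> s10; have sN : size s < N by lia.
have [//|h] := pselect (exists2 x, lv x & x \notin s); exfalso.
have uV : uniq [seq V i 0 | i <- iota 0 N].
  by rewrite map_inj_uniq ?iota_uniq // => i j [].
have sV : {subset [seq V i 0 | i <- iota 0 N] <= s}.
  move=> x /mapP[i]; rewrite mem_iota add0n /= => iN ->.
  by apply: contrapT => /negP is_; apply: h; exists (V i 0) => //=; lia.
by have := uniq_leq_size uV sV; rewrite size_map size_iota leqNgt sN.
Qed.

(** A good f lets the group move whole letters onto bricks with map f ([good_map]). The labels are
    good, and good maps compose. *)
Definition good f := forall x y z, lv x -> lv y -> lv z -> x != y -> y != z ->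
  x != z -> has3 P (brick x f) (brick y id) (brick z id).

Lemma good_id : good id.
Proof. by move=> x y z lx ly lz; exact: live_t3. Qed.

(** The spare letter [d] turns the wanted exchange of z with the brick into a 3-cycle. *)
Lemma good_map f x z d : good f -> lv x -> lv z -> lv d ->
  x != d -> d != z -> x != z ->
  exists p, [/\ P p, forall w, p (z, w) = (x, f w) &
    forall u, u.1 != z -> u.1 != d -> (forall w, u <> (x, f w)) -> p u = u].
Proof.
move=> gf lx lz ld xd dz xz; have [p Pp [p1 p2 p3 pf]] := gf x d z lx ld lz xd dz xz.
exists p; split => // u uz ud ux; apply: pf => // w uE.
  by rewrite uE eqxx in ud.
by rewrite uE eqxx in uz.
Qed.

Section Normal.
Variable M : set (sym Y).
Hypothesis MV : forall x, M x -> M x^-1%g.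
Hypothesis MJ : forall p x, P p -> M x -> M (p * x * p^-1)%g.

Lemma move_letter x x' y z f g h : lv x -> lv x' -> lv y -> lv z ->
  x \notin [:: y; z] -> x' \notin [:: y; z] ->
  has3 M (brick x f) (brick y g) (brick z h) ->
  has3 M (brick x' f) (brick y g) (brick z h).
Proof.
move=> lx lx' ly lz; rewrite !inE !negb_or => /andP[xy xz] /andP[xy' xz'].
have [->//|xx'] := eqVneq x x'.
have [//|d ld] := @fresh [:: x; x'; y; z].
rewrite !inE !negb_or => /and4P[dx dx' dy dz].
have x'd : x' != d by rewrite eq_sym.
have x'x : x' != x by rewrite eq_sym.
have [p [Pp px pf]] := good_map good_id lx' lx ld x'd dx x'x.
apply: (has3_conj MJ Pp) => w; first exact: px.
- by apply: pf => [||v] /=; neq.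
- by apply: pf => [||v] /=; neq.
Qed.

Lemma move_letters x y z x' y' z' f :
  all lv [:: x; y; z; x'; y'; z'] -> uniq [:: x; y; z] -> uniq [:: x'; y'; z'] ->
  has3 M (brick x f) (brick y id) (brick z id) ->
  has3 M (brick x' f) (brick y' id) (brick z' id).
Proof.
rewrite /= !andbT !inE !negb_or => /and5P[lx ly lz lx' /andP[ly' lz']].
move=> /andP[/andP[xy xz] yz] /andP[/andP[xy' xz'] yz'] h.
(* The new letters may be old ones in other places, so y and z are first parked at the fresh letters
   a and b. *)
have [//|a la] := @fresh [:: x; y; z; x'; y'; z'].
rewrite !inE !negb_or => /and5P[ax ay az ax' /andP[ay' az']].
have [//|b lb] := @fresh [:: a; x; y; z; x'; y'; z'].
rewrite !inE !negb_or => /and5P[ba bx by_ bz /and3P[bx' by' bz']].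
have {h} h : has3 M (brick a id) (brick z id) (brick x f).
  apply: (@move_letter y a); rewrite // ?inE ?negb_or ?az ?ax ?yz 1?[y == x]eq_sym ?xy //.
  exact: has3_rot.
have {h} h : has3 M (brick b id) (brick x f) (brick a id).
  apply: (@move_letter z b); rewrite // ?inE ?negb_or ?bx ?ba 1?[z == x]eq_sym ?xz 1?[z == a]eq_sym ?az //.
  exact: has3_rot.
have {h} h : has3 M (brick x' f) (brick a id) (brick b id).
  apply: (@move_letter x x'); rewrite // ?inE ?negb_or 1?[x == a]eq_sym ?ax 1?[x == b]eq_sym ?bx
    1?[x' == a]eq_sym ?ax' 1?[x' == b]eq_sym ?bx' //.
  exact: has3_rot.
have {h} h : has3 M (brick y' id) (brick b id) (brick x' f).
  apply: (@move_letter a y'); rewrite // ?inE ?negb_or ?ax' 1?[a == b]eq_sym ?ba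
    1?[y' == b]eq_sym ?by' 1?[y' == x']eq_sym ?xy' //.
  exact: has3_rot.
have {h} h : has3 M (brick z' id) (brick x' f) (brick y' id).
  apply: (@move_letter b z'); rewrite // ?inE ?negb_or ?bx' ?by'
    1?[z' == x']eq_sym ?xz' 1?[z' == y']eq_sym ?yz' //.
  exact: has3_rot.
exact: has3_rot.
Qed.

Definition letters3 := forall x y z, lv x -> lv y -> lv z ->
  x != y -> y != z -> x != z -> has3 M (brick x id) (brick y id) (brick z id).

(** Start from three fresh letters and move each onto its brick by conjugation; disjointness keeps
    the bricks already placed where they are. *)
Lemma bricks3 x1 x2 x3 f1 f2 f3 : letters3 -> lv x1 -> lv x2 -> lv x3 ->
  good f1 -> good f2 -> good f3 ->
  disj (brick x1 f1) (brick x2 f2) -> disj (brick x2 f2) (brick x3 f3) ->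
  disj (brick x1 f1) (brick x3 f3) ->
  has3 M (brick x1 f1) (brick x2 f2) (brick x3 f3).
Proof.
move=> M3 l1 l2 l3 g1 g2 g3 d12 d23 d13.
have [//|d ld] := @fresh [:: x1; x2; x3].
rewrite !inE !negb_or => /and3P[dx1 dx2 dx3].
have [//|y1 ly1] := @fresh [:: d; x1; x2; x3].
rewrite !inE !negb_or => /and4P[y1d y1x1 y1x2 y1x3].
have [//|y2 ly2] := @fresh [:: y1; d; x1; x2; x3].
rewrite !inE !negb_or => /and5P[y2y1 y2d y2x1 y2x2 y2x3].
have [//|y3 ly3] := @fresh [:: y1; y2; d; x1; x2; x3].
rewrite !inE !negb_or => /and5P[y3y1 y3y2 y3d y3x1 /andP[y3x2 y3x3]].
have h := M3 y1 y2 y3 ly1 ly2 ly3; rewrite [y1 == y2]eq_sym [y2 == y3]eq_sym [y1 == y3]eq_sym in h.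
have {}h := h y2y1 y3y2 y3y1.
have S := fun a b : letter => eq_sym a b.
have [p1 [Pp1 p1y p1f]] : exists p, [/\ P p, forall w, p (y1, w) = (x1, f1 w) &
    forall u, u.1 != y1 -> u.1 != d -> (forall w, u <> (x1, f1 w)) -> p u = u].
  by apply: good_map => //; neq.
have [p2 [Pp2 p2y p2f]] : exists p, [/\ P p, forall w, p (y2, w) = (x2, f2 w) &
    forall u, u.1 != y2 -> u.1 != d -> (forall w, u <> (x2, f2 w)) -> p u = u].
  by apply: good_map => //; neq.
have [p3 [Pp3 p3y p3f]] : exists p, [/\ P p, forall w, p (y3, w) = (x3, f3 w) &
    forall u, u.1 != y3 -> u.1 != d -> (forall w, u <> (x3, f3 w)) -> p u = u].
  by apply: good_map => //; neq.
have {h} h : has3 M (brick x1 f1) (brick y2 id) (brick y3 id).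
  apply: (has3_conj MJ Pp1) h => w; first exact: p1y.
  - by apply: p1f => [||v] /=; neq.
  - by apply: p1f => [||v] /=; neq.
have {h} h : has3 M (brick x1 f1) (brick x2 f2) (brick y3 id).
  apply: (has3_conj MJ Pp2) h => w; [|exact: p2y|].
  - by apply: p2f => [||v] /=; [neq|neq|exact: d12].
  - by apply: p2f => [||v] /=; neq.
apply: (has3_conj MJ Pp3) h => w; [| |exact: p3y].
- by apply: p3f => [||v] /=; [neq|neq|exact: d13].
- by apply: p3f => [||v] /=; [neq|neq|exact: d23].
Qed.

End Normal.

Lemma big_letters3 : letters3 P.
Proof. exact: good_id. Qed.

(** The element moving the letter v onto the brick of f in x moves the brick of g in v onto that of
    f \o g in x. *)
Lemma good_comp f g : good f -> good g -> good (f \o g).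
Proof.
move=> gf gg x y z lx ly lz xy yz xz.
have [//|v lv_] := @fresh [:: x; y; z].
rewrite !inE !negb_or => /and3P[vx vy vz].
have [//|d ld] := @fresh [:: v; x; y; z].
rewrite !inE !negb_or => /and4P[dv dx dy dz].
have xd : x != d by rewrite eq_sym.
have xv : x != v by rewrite eq_sym.
have [p [Pp pv pf]] := good_map gf lx lv_ ld xd dv xv.
apply: (has3_conj big_groupJ Pp) (gg v y z lv_ ly lz vy yz vz) => w; first exact: pv.
- by apply: pf => [||u] /=; neq.
- by apply: pf => [||u] /=; neq.
Qed.

Lemma good_ext f g : f =1 g -> good f -> good g.
Proof. by move/funext => ->. Qed.

(** Here the labels come in: conjugation by alpha takes the letter at one end of the link to the
    labelled brick at the other end. *)
Lemma good_link k : k < t -> good (gact (nth (Nop H) lk k)).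
Proof.
move=> kt x y z lx ly lz xy yz xz.
have : has3 P (brick (V (6 * k + 4) 2) (gact (nth (Nop H) lk k)))
    (brick (V N.-1 1) id) (brick (V 1 0) id).
  apply: (has3_conj big_groupJ big_group_al)
    (_ : has3 P (brick (V (6 * k + 1) 2) id) (brick (V N.-1 1) id) (brick (V 0 1) id)).
  - by move=> w; exact: alpha_link0.
  - by move=> w; rewrite /brick alpha_fixV //; lia.
  - by move=> w; rewrite /brick alpha_r //; lia.
  by apply: good_id => /=; (apply/eqP => -[]) || idtac; lia.
apply: (move_letters big_groupJ).
- by rewrite /= lx ly lz; lia.
- by rewrite /= !inE; apply/and3P; split => //; [rewrite negb_or; apply/andP; split|];
    apply/eqP => -[]; lia.
- by rewrite /= !inE negb_or xy yz xz.
Qed.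

(** For a bijection f the brick of f in u is the whole letter u, and an element taking it to x acts
    on u as g. *)
Lemma good_inverse f g : cancel f g -> cancel g f -> good f -> good g.
Proof.
move=> fK gK gf x y z lx ly lz xy yz xz.
have [//|u lu] := @fresh [:: x; y; z].
rewrite !inE !negb_or => /and3P[ux uy uz].
have [//|v lv_] := @fresh [:: u; x; y; z].
rewrite !inE !negb_or => /and4P[vu vx vy vz].
have xv : x != v by rewrite eq_sym.
have [p Pp [p1 p2 p3 pf]] := gf u x v lu lx lv_ ux xv (etrans (congr1 _ (eq_sym u v)) vu).
apply: (has3_conj big_groupJ Pp)
  (_ : has3 P (brick u id) (brick y id) (brick z id)).
- by move=> w; have := p1 (g w); rewrite /brick gK.
- by move=> w; apply: pf => r; neq.
- by move=> w; apply: pf => r; neq.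
exact: good_id.
Qed.

End BigGroup.

(** * Simplicity, embedding, distortion *)

Section Embedding.
Variables (H : groupType) (S : seq H).
Hypothesis S_gen : generates S.

Definition links : seq (gen H) :=
  [:: Push None false; Push None true; Push (Some 1%g) false; Push (Some 1%g) true]
  ++ [seq Act h | h <- S].

Variables (m n N : nat).
Local Notation lk := links.
Local Notation W := (stream H).
Local Notation Y := (letter * W)%type.
Local Notation t := (size lk).
Local Notation K := (m + n - 3).
Hypothesis m_ge2 : 2 <= m.
Hypothesis n_ge3 : 3 <= n.
Hypothesis N_large : 6 * t + 10 <= N.
Hypothesis N_prime : prime N.+1.
Hypothesis N_large1 : (1 + 4 * t) * K + 1 < N.
Hypothesis N_large2 : 4 * K + m < N.

Local Notation al := (alpha m_ge2 n_ge3 N_large).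
Local Notation be := (beta m_ge2 n_ge3 N_large).
Local Notation lv := (live m n N lk).
Local Notation P := (big_group m_ge2 n_ge3 N_large).
Local Notation good := (good m_ge2 n_ge3 N_large).

Let PV := @big_groupV _ _ _ _ _ m_ge2 n_ge3 N_large.
Let PM := @big_groupM _ _ _ _ _ m_ge2 n_ge3 N_large.
Let PJ := @big_groupJ _ _ _ _ _ m_ge2 n_ge3 N_large.
Let P3 := big_letters3 m_ge2 n_ge3 N_large N_prime N_large1 N_large2.
Let fr := fresh m_ge2 n_ge3 N_large N_prime N_large1 N_large2.
Let goodI := good_id m_ge2 n_ge3 N_large N_prime N_large1 N_large2.

Lemma good_nth k : k < t -> good (gact (nth (Nop H) lk k)).
Proof. exact: good_link. Qed.

Lemma good_comp' f g : good f -> good g -> good (f \o g).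
Proof. exact: good_comp. Qed.

Lemma good_act h : good (gact (Act h)).
Proof.
suff : good (gact (Act h)) /\ good (gact (Act h^-1%g)) by case.
have inv k : good (gact (Act k)) -> good (gact (Act k^-1%g)).
  move=> gk; apply: (@good_inverse _ _ _ _ _ _ _ _ N_prime N_large1 N_large2 _ _ _ _ gk).
    exact: (gactK (Act k)).
  by move=> w; exact: (@ginvK _ (Act k)).
have gM k l : good (gact (Act k)) -> good (gact (Act l)) -> good (gact (Act (k * l)%g)).
  move=> gk gl; apply: good_ext (good_comp' gk gl) => w; exact: gactM.
elim/(@generates_ind _ S): h => //.
- by rewrite invg1; split; apply: good_ext goodI => w; rewrite gact1.
- by move=> k l [gk gk'] [gl gl']; rewrite invgM; split; exact: gM.
- by move=> k [gk gk']; rewrite invgK.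
move=> h hS; suff : good (gact (Act h)) by move=> gh; split => //; exact: inv.
have := @good_nth (4 + index h S).
have -> : nth (Nop H) lk (4 + index h S) = Act h.
  by rewrite [LHS](_ : _ = nth (Nop H) [seq Act h | h <- S] (index h S)) //
    (nth_map 1%g) ?index_mem // nth_index.
by apply; rewrite size_cat size_map ltn_add2l index_mem.
Qed.

Lemma good_gen a : good (gact a).
Proof.
case: a => [|[h|] b|h]; [exact: goodI| | |exact: good_act].
  apply: good_ext (gact_conj h b) _; apply: good_comp'; first exact: good_act.
  apply: good_comp'; last exact: good_act.
  by case: b; [exact: (@good_nth 3)|exact: (@good_nth 2)].
by case: b; [exact: (@good_nth 1)|exact: (@good_nth 0)].
Qed.

Lemma good_gword f : gword f -> good f.
Proof.
elim=> [|a g _ gg]; first exact: goodI.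
by apply: good_comp' gg; exact: good_gen.
Qed.

Definition half b := gact (Push (H := H) None b).

Lemma half_cases w : (exists v, w = half false v) \/ (exists v, w = half true v).
Proof.
by case wE: (w None 0); [right|left]; exists (ginv (Push None (w None 0)) w);
  rewrite -wE /half ginvK /=.
Qed.

Lemma half_disj v w : half false v <> half true w.
Proof. by move/(congr1 (fun w : W => w None 0)). Qed.

Lemma half_inj b : injective (half b).
Proof. exact: gact_inj. Qed.

Lemma big_group_cont g : P g -> cont g.
Proof.
move=> Pg; suff [] : cont g /\ cont (g^-1)%g by [].
(* Alpha and beta have finite order, so their inverses are powers and are continuous too. *)
have cX (x : sym Y) k : 0 < k -> (x ^+ k)%g = 1%g -> cont x -> cont (x^-1)%g.
  move=> k0 xk cx; have -> : (x^-1 = x ^+ k.-1)%g.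
    by apply: (mulgI x); rewrite mulgV -expgS prednK.
  have -> : ((x ^+ k.-1)%g : Y -> Y) = iter k.-1 x by apply/funext => y; rewrite symXE.
  exact: cont_iter.
elim/big_group_ind: Pg => [|x y [cx cx'] [cy cy']|x [cx cx']||].
- by rewrite invg1; split; exact: cont_id.
- by rewrite invgM; split; exact: cont_comp.
- by rewrite invgK.
- have [m0 am _] := alpha_order m_ge2 n_ge3 N_large.
  by have ca := alpha_cont m_ge2 n_ge3 N_large; split => //; exact: cX m0 am ca.
- have [n0 bn _] := beta_order m_ge2 n_ge3 N_large.
  by have cb := beta_cont m_ge2 n_ge3 N_large; split => //; exact: cX n0 bn cb.
Qed.

Lemma big_group_dead g x w : P g -> ~~ lv x -> g (x, w) = (x, w).
Proof.
move=> Pg dx; elim/big_group_ind: Pg => [//|a b aE bE|a aE||].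
- by rewrite symME bE.
- exact: sym_fixV.
- exact: alpha_dead.
- exact: beta_dead.
Qed.

(** At a moved point the letter or one digit changes. By continuity this persists on a
    neighbourhood, which contains a brick. *)
Lemma big_group_moves g : P g -> g <> 1%g -> exists x f, [/\ lv x, gword f &
  forall v w, g (x, f v) <> (x, f w)].
Proof.
move=> Pg g1; have [[x w] gxw] : exists y, g y <> y.
  by apply: contrapT => h; apply: g1; apply: symP => y; apply: contrapT => gy; apply: h; exists y.
have [F FP] : exists F, (g (x, w)).1 = x -> forall u v : W,
    agree F u (g (x, w)).2 -> agree F v w -> u <> v.
  case gE: (g (x, w)) => [x' w'] /=; have [xx|xx] := eqVneq x' x; last first.
    by exists [::] => xE; rewrite xE eqxx in xx.
  have [[s i] si] : exists p, w' p.1 p.2 <> w p.1 p.2.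
    apply: contrapT => h; apply: gxw; rewrite gE xx; congr (_, _).
    by apply: streamP => s i; apply: contrapT => si; apply: h; exists (s, i).
  exists [:: (s, i)] => _ u v uw vw uv; apply: si => /=.
  by rewrite -(uw s i) ?inE // -(vw s i) ?inE // uv.
have [F' F'P] := big_group_cont Pg x w F.
have [f ff [_ fP]] := gword_nbhd (F' ++ F) w.
exists x, f; split => //.
  by apply: contrapT => /negP dx; apply: gxw; exact: big_group_dead.
move=> v u gv; have [/F'P[e1 a2] _] := agree_cat (fP v).
have [_ a3] := agree_cat (fP u).
rewrite gv /= in e1 a2; exact: (FP (esym e1) _ _ a2 a3 erefl).
Qed.

(** * Normal subgroups *)

Section Simplicity.
Variable M : set (sym Y).
Hypothesis MP : forall x, M x -> P x.
Hypothesis M1 : M 1%g.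
Hypothesis MM : forall x y, M x -> M y -> M (x * y)%g.
Hypothesis MV : forall x, M x -> M x^-1%g.
Hypothesis MJ : forall p x, P p -> M x -> M (p * x * p^-1)%g.

(* If p is supported in a brick that g moves off itself, then g p^-1 g^-1 p acts on
   this brick as p does. *)
Lemma normal_contains_3cycle g x f : M g -> lv x -> gword f ->
  (forall v w, g (x, f v) <> (x, f w)) ->
  exists f1 f2 f3, [/\ [/\ gword f1, gword f2 & gword f3],
    disj (brick x f1) (brick x f2), disj (brick x f1) (brick x f3),
    disj (brick x f2) (brick x f3) &
    has3 M (brick x f1) (brick x f2) (brick x f3)].
Proof.
move=> Mg lx ff gf.
(* Repeated halving cuts the brick into five. Of these p will permute e1, e2, e3 and q will permute
   e1, e4, e5. *)
pose e1 := half false; pose e2 := half true \o half false.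
pose e3 := half true \o half true \o half false.
pose e4 := half true \o half true \o half true \o half false.
pose e5 := half true \o half true \o half true \o half true.
have hw b : gword (half b) by exact: gword_gen.
have w1 : gword (f \o e1) := gword_cat ff (hw _).
have w2 : gword (f \o e2) := gword_cat ff (gword_cat (hw _) (hw _)).
have w3 : gword (f \o e3) := gword_cat ff (gword_cat (gword_cat (hw _) (hw _)) (hw _)).
have hw3 : gword (half true \o half true \o half true) :=
  gword_cat (gword_cat (hw _) (hw _)) (hw _).
have w4 : gword (f \o e4) := gword_cat ff (gword_cat hw3 (hw _)).
have w5 : gword (f \o e5) := gword_cat ff (gword_cat hw3 (hw _)).
have dj a b : (forall v w, a v <> b w) -> disj (brick x (f \o a)) (brick x (f \o b)).
  by move=> ab v w [] /(gword_inj ff); exact: ab.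
have d v w : half true v <> half false w by move/esym; exact: half_disj.
have h12 v w : e1 v <> e2 w by exact: half_disj.
have h13 v w : e1 v <> e3 w by exact: half_disj.
have h14 v w : e1 v <> e4 w by exact: half_disj.
have h15 v w : e1 v <> e5 w by exact: half_disj.
have h23 v w : e2 v <> e3 w by move/half_inj; exact: half_disj.
have h24 v w : e2 v <> e4 w by move/half_inj; exact: half_disj.
have h25 v w : e2 v <> e5 w by move/half_inj; exact: half_disj.
have h34 v w : e3 v <> e4 w by do 2 move/half_inj; exact: half_disj.
have h35 v w : e3 v <> e5 w by do 2 move/half_inj; exact: half_disj.
have h45 v w : e4 v <> e5 w by do 3 move/half_inj; exact: half_disj.
have T a b c : gword (f \o a) -> gword (f \o b) -> gword (f \o c) ->
    (forall v w, a v <> b w) -> (forall v w, b v <> c w) -> (forall v w, a v <> c w) ->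
    has3 P (brick x (f \o a)) (brick x (f \o b)) (brick x (f \o c)).
  move=> wa wb wc ab bc ac.
  by apply: (bricks3 N_prime N_large1 N_large2 PJ P3) => //; first [exact: good_gword|exact: dj].
have [p Pp [p12 p23 p31 pf]] := T _ _ _ w1 w2 w3 h12 h23 h13.
have [q Pq [q14 q45 q51 qf]] := T _ _ _ w1 w4 w5 h14 h45 h15.
(* Within the brick k acts as p, and elsewhere q is trivial; so the supports of k and q meet only in
   e1. *)
pose k := (g * (p^-1 * g^-1 * p))%g.
have Mk : M k.
  apply: MM => //; rewrite -[p in (_ * p)%g]invgK.
  by apply: MJ; [exact: PV|exact: MV].
have p_out y : (forall w, y <> (x, f w)) -> p y = y.
  by move=> ny; apply: pf => w; exact: ny.
have k_in y w : p y = (x, f w) -> k y = p y.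
  move=> py; rewrite !symME py.
  suff -> : (p^-1)%g ((g^-1)%g (x, f w)) = (g^-1)%g (x, f w) by rewrite symKV.
  apply/sym_fixV/p_out => v gv; apply: (gf v w); rewrite -gv; exact: symKV.
have k1 w : k (brick x (f \o e1) w) = brick x (f \o e2) w.
  by rewrite (k_in _ (e2 w)) p12.
have k3 w : k (brick x (f \o e3) w) = brick x (f \o e1) w.
  by rewrite (k_in _ (e1 w)) p31.
have kfix a w : (forall v, e1 v <> a w) -> (forall v, e2 v <> a w) -> (forall v, e3 v <> a w) ->
    k (brick x (f \o a) w) = brick x (f \o a) w.
  move=> a1 a2 a3; have pa : p (brick x (f \o a) w) = brick x (f \o a) w.
    by apply: pf => v [] /(gword_inj ff) /esym; [exact: a1|exact: a2|exact: a3].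
  by rewrite (k_in _ (a w)) pa.
exists (f \o e1), (f \o e2), (f \o e4); split; [by split|exact: dj|exact: dj|exact: dj|].
have c3 : is3 (k * q * k^-1 * q^-1)%g (brick x (f \o e1))
    (k \o brick x (f \o e1)) (q \o brick x (f \o e1)).
  apply: is3_commutator => [w|w|w|w|y ny].
  - rewrite k1; apply: qf => v [] /(gword_inj ff); [|exact: h24|exact: h25].
    by move/esym; exact: h12.
  - by rewrite q14 kfix.
  - rewrite (sym_eqV (k3 w)); apply: qf => v [] /(gword_inj ff); [|exact: h34|exact: h35].
    by move/esym; exact: h13.
  - by rewrite (sym_eqV (q51 w)) kfix.
  have [[w ->]|n4] := pselect (exists w, y = brick x (f \o e4) w); first by left; exact: kfix.
  have [[w ->]|n5] := pselect (exists w, y = brick x (f \o e5) w); first by left; exact: kfix.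
  by right; apply: qf => // w yw; [apply: n4|apply: n5]; exists w.
exists (k * q * k^-1 * q^-1)%g.
  have -> : (k * q * k^-1 * q^-1 = k * (q * k^-1 * q^-1))%g by rewrite !mulgA.
  by apply: MM => //; apply: MJ => //; exact: MV.
by apply: is3_ext c3 => // w; rewrite /comp ?k1 ?q14.
Qed.

(** The inverses of the maps from fresh letters onto the three bricks bring the 3-cycle to whole
    letters, and [move_letters] spreads it. *)
Lemma normal_letters3 x f1 f2 f3 : lv x -> gword f1 -> gword f2 -> gword f3 ->
  disj (brick x f1) (brick x f2) -> disj (brick x f1) (brick x f3) ->
  disj (brick x f2) (brick x f3) ->
  has3 M (brick x f1) (brick x f2) (brick x f3) -> letters3 m n N lk M.
Proof.
move=> lx w1 w2 w3 d12 d13 d23 h.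
have sy (a b : letter) : a != b -> b != a by rewrite eq_sym.
have [//|d ld] := fr (s := [:: x]); rewrite !inE => dx.
have [//|y1 ly1] := fr (s := [:: d; x]); rewrite !inE !negb_or => /andP[y1d y1x].
have [//|y2 ly2] := fr (s := [:: y1; d; x]).
rewrite !inE !negb_or => /and3P[y2y1 y2d y2x].
have [//|y3 ly3] := fr (s := [:: y1; y2; d; x]).
rewrite !inE !negb_or => /and4P[y3y1 y3y2 y3d y3x].
have [p1 [Pp1 p1y p1f]] :=
  good_map (good_gword w1) lx ly1 ld (sy _ _ dx) (sy _ _ y1d) (sy _ _ y1x).
have [p2 [Pp2 p2y p2f]] :=
  good_map (good_gword w2) lx ly2 ld (sy _ _ dx) (sy _ _ y2d) (sy _ _ y2x).
have [p3 [Pp3 p3y p3f]] :=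
  good_map (good_gword w3) lx ly3 ld (sy _ _ dx) (sy _ _ y3d) (sy _ _ y3x).
have {}h : has3 M (brick y1 id) (brick x f2) (brick x f3).
  apply: (has3_conj MJ (PV Pp1)) h => w; first exact/sym_eqV/p1y.
  - apply/sym_fixV/p1f => [||v]; [exact: sy|exact: sy|exact/nesym/d12].
  - apply/sym_fixV/p1f => [||v]; [exact: sy|exact: sy|exact/nesym/d13].
have {}h : has3 M (brick y1 id) (brick y2 id) (brick x f3).
  apply: (has3_conj MJ (PV Pp2)) h => w; [|exact/sym_eqV/p2y|].
  - by apply/sym_fixV/p2f => [||v] /=; [exact: sy| |exact: brick_neq].
  - apply/sym_fixV/p2f => [||v]; [exact: sy|exact: sy|exact/nesym/d23].
have {}h : has3 M (brick y1 id) (brick y2 id) (brick y3 id).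
  apply: (has3_conj MJ (PV Pp3)) h => w; [| |exact/sym_eqV/p3y].
  - by apply/sym_fixV/p3f => [||v] /=; [exact: sy| |exact: brick_neq].
  - by apply/sym_fixV/p3f => [||v] /=; [exact: sy| |exact: brick_neq].
move=> x1 x2 x3 l1 l2 l3 n12 n23 n13.
apply: (move_letters N_prime N_large1 N_large2 MJ) h.
- by rewrite /= ly1 ly2 ly3 l1 l2 l3.
- by rewrite /= !inE negb_or (sy _ _ y2y1) (sy _ _ y3y1) (sy _ _ y3y2).
- by rewrite /= !inE negb_or n12 n13 n23.
Qed.

Lemma normal_is2 x y f g s : letters3 m n N lk M -> lv x -> lv y -> x != y ->
  gword f -> gword g -> is2 s (brick x f) (brick y g) -> M s.
Proof.
move=> M3 lx ly xy wf wg; have yx : y != x by rewrite eq_sym.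
have wh h b : gword h -> good (h \o half b).
  by move=> wh; apply/good_gword/gword_cat => //; exact: gword_gen.
have dh z h : gword h -> disj (brick z (h \o half false)) (brick z (h \o half true)).
  by move=> wh' v w [] /(gword_inj wh'); exact: half_disj.
have bI z h : gword h -> injective (brick z h).
  by move=> wh' v w [] /(gword_inj wh').
have B := bricks3 N_prime N_large1 N_large2 MJ M3.
apply: (is2_halves MM half_cases half_disj); [exact: bI|exact: bI|exact: disj_brick| |].
- by apply: (B x y x) => //; first [exact: wh|exact: disj_brick|exact: dh].
- by apply: (B y x y) => //; first [exact: wh|exact: disj_brick|exact: dh].
Qed.

Lemma normal_all g : M g -> g <> 1%g -> M al /\ M be.
Proof.
move=> Mg g1; have [x [f [lx wf gf]]] := big_group_moves (MP Mg) g1.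
have [f1 [f2 [f3 [[w1 w2 w3] d12 d13 d23 h]]]] := normal_contains_3cycle Mg lx wf gf.
have M3 := normal_letters3 lx w1 w2 w3 d12 d13 d23 h.
have wgen a : gword (gact (H := H) a) by exact: gword_gen.
split.
  apply: (@rot_transpositions _ _ M M1 MM (ltA n N lk) (fun e j => gact (gnA N lk e j))
    (N + 3 * t) m) => //; [by move=> e j; exact: gact_inj|lia|exact: ltA_inj|].
  move=> e j j' s le jm jm' jj'; apply: normal_is2 => //; try exact: live_ltA.
  by apply/eqP => /(ltA_inj m_ge2 n_ge3 N_large le le jm jm')[_]; exact: jj'.
apply: (@rot_transpositions _ _ M M1 MM ltB (fun e j => gact (gnB H e j)) N n) => //;
  [by move=> e j; exact: gact_inj|lia|exact: ltB_inj|].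
move=> e j j' s le jm jm' jj'; apply: normal_is2 => //=; try lia.
by apply/eqP => -[].
Qed.

End Simplicity.

(** * The embedding of H *)

Definition embed_fun (h : H) (y : Y) : Y :=
  if (y.1 == V 0 0) && y.2 None 0 then (y.1, gact (Act h) y.2) else y.

Lemma embed_fun_in h x w : (x == V 0 0) && w None 0 ->
  embed_fun h (x, w) = (x, gact (Act h) w).
Proof. by rewrite /embed_fun => ->. Qed.

Lemma embed_fun_out h x w : ~~ ((x == V 0 0) && w None 0) -> embed_fun h (x, w) = (x, w).
Proof. by rewrite /embed_fun => /negbTE ->. Qed.

Fact embed_funK h : cancel (embed_fun h) (embed_fun h^-1%g).
Proof.
move=> [x w]; have [xw|xw] := boolP ((x == V 0 0) && w None 0); last by rewrite !embed_fun_out.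
by rewrite embed_fun_in // embed_fun_in // gactM mulVg gact1.
Qed.

Fact embed_funVK h : cancel (embed_fun h^-1%g) (embed_fun h).
Proof. by move=> y; rewrite -{1}[h]invgK embed_funK. Qed.

Definition embed h : sym Y := Sym (embed_funK h) (embed_funVK h).

Lemma embedM h k : embed (h * k)%g = (embed h * embed k)%g.
Proof.
apply: symP => -[x w]; have [xw|xw] := boolP ((x == V 0 0) && w None 0).
  by rewrite symME [LHS]embed_fun_in // [embed k _]embed_fun_in // [RHS]embed_fun_in // gactM.
by rewrite symME [LHS]embed_fun_out // [embed k _]embed_fun_out // [RHS]embed_fun_out.
Qed.

Lemma live0 : lv (V 0 0). Proof. rewrite /=; lia. Qed.

(** The quotient of two 3-cycles on the letters x, y, z, one of which is twisted by h at x. *)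
Lemma big_group_pure h x z : lv x -> lv z -> x != z -> exists A, [/\ P A,
  forall w, A (x, w) = (x, gact (Act h^-1%g) w),
  forall w, A (z, w) = (z, gact (Act h) w) &
  forall y, y.1 != x -> y.1 != z -> A y = y].
Proof.
move=> lx lz xz; have [//|y ly] := fr (s := [:: x; z]).
rewrite !inE !negb_or => /andP[yx yz].
have xy : x != y by rewrite eq_sym.
have [g1 Pg1 [a1 a2 a3 af]] := good_act h lx ly lz xy yz xz.
have [g0 Pg0 [b1 b2 b3 bf]] := P3 lx ly lz xy yz xz.
rewrite /brick in a1 a2 a3 af b1 b2 b3 bf.
have out u v : u.1 != v -> forall r, u <> (v, r) :> Y.
  by move=> uv r uE; rewrite uE eqxx in uv.
exists (g0^-1 * g1)%g; split.
- by apply: PM => //; exact: PV.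
- move=> w; rewrite symME; apply: sym_eqV; rewrite b1.
  by rewrite -a1 gactM mulgV gact1.
- by move=> w; rewrite symME a3; apply: sym_eqV; rewrite b3.
move=> u ux uz; rewrite symME; have [uy|uy] := eqVneq u.1 y.
  by case: u uy {ux uz} => [u w] /= ->; rewrite a2; apply: sym_eqV; rewrite b2.
by rewrite af; [apply/sym_fixV/bf| | |] => w; exact: out.
Qed.

(* The group contains the element acting as h^-1 on the letter V 0 0 and as h on
   another letter z, and also the same with V 0 0 replaced by one of its halves.
   Their quotient is h on the other half. *)
Lemma big_group_embed h : P (embed h).
Proof.
have [//|v lv_] := fr (s := [:: V 0 0]); rewrite !inE => v0.
have [//|z lz] := fr (s := [:: v; V 0 0]); rewrite !inE negb_or => /andP[zv z0].
have [//|d ld] := fr (s := [:: z; v; V 0 0]).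
rewrite !inE !negb_or => /and3P[dz dv d0].
have l0 := live0.
have sy (a b : letter) : a != b -> b != a by rewrite eq_sym.
have [A [PA A0 Az Af]] := big_group_pure h l0 lz (sy _ _ z0).
have [B [PB Bv Bz Bf]] := big_group_pure h lv_ lz (sy _ _ zv).
(* Here p moves v onto the half of V 0 0 with first digit [false], so p B p^-1 is h^-1 on that half
   and h on z. *)
have [p [Pp pv pf]] := good_map (good_gen (Push None false)) l0 lv_ ld
  (sy _ _ d0) dv (sy _ _ v0).
suff -> : embed h = (p * B * p^-1 * A^-1)%g.
  by apply: PM; [exact: PJ|exact: PV].
have pz w : p (z, w) = (z, w).
  by apply: pf => //=; [exact: sy|move=> u [] zE; rewrite zE eqxx in z0].
apply: symP => -[x w]; rewrite !symME.
have [xz|xz] := eqVneq x z.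
  have Azw : (A^-1)%g (z, w) = (z, gact (Act h^-1%g) w).
    by apply: sym_eqV; rewrite Az gactM mulgV gact1.
  rewrite xz Azw (sym_fixV (pz _)) Bz pz gactM mulgV gact1 /= /embed_fun /=.
  by rewrite (negbTE z0).
have [x0|x0] := eqVneq x (V 0 0); last first.
  have Axw : (A^-1)%g (x, w) = (x, w) by apply/sym_fixV/Af.
  have -> : embed h (x, w) = (x, w) by rewrite /= /embed_fun /= (negbTE x0).
  rewrite Axw [B _]Bf ?symKV //.
    apply/eqP; case pxw : ((p^-1)%g (x, w)) => [x' w'] /= xv.
    move: pxw; rewrite xv => /(congr1 p); rewrite symKV pv => -[xE _].
    by rewrite xE eqxx in x0.
  apply/eqP; case pxw : ((p^-1)%g (x, w)) => [x' w'] /= xv.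
  move: pxw; rewrite xv => /(congr1 p); rewrite symKV pz => -[xE _].
  by rewrite xE eqxx in xz.
rewrite x0.
have -> : (A^-1)%g (V 0 0, w) = (V 0 0, gact (Act h) w).
  by apply: sym_eqV; rewrite A0 gactM mulVg gact1.
have [[u ->]|[u ->]] := half_cases w; rewrite /half gact_pushN.
  have -> : (p^-1)%g (V 0 0, gact (Push None false) (gact (Act h) u)) = (v, gact (Act h) u).
    by apply: sym_eqV; rewrite pv.
  by rewrite Bv pv gactM mulVg gact1.
rewrite [LHS]embed_fun_in // gact_pushN.
pose y : Y := (V 0 0, gact (Push None true) (gact (Act h) u)).
have py : p y = y.
  apply: pf => /=; [exact: sy|exact: sy|move=> r [] rE].
  by have := half_disj (esym rE).
by rewrite (sym_fixV py) Bf ?py //=; exact: sy.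
Qed.

(** The translating element may vary with the point; only its length is bounded. This is the length
    function that [qi_embedding_of_bounds] needs, up to a constant factor. *)
Definition displaces (g : sym Y) k := forall y, exists2 c, word_length S c <= k &
  forall r, ev (g y).2 r <-> ev y.2 (c^-1 * r)%g.

Lemma displaces1 : displaces 1%g 0.
Proof. by move=> y; exists 1%g => [|r]; rewrite ?word_length1 // invg1 mul1g. Qed.

Lemma displacesM g h k l : displaces g k -> displaces h l -> displaces (g * h)%g (k + l).
Proof.
move=> dg dh y; have [c ck cE] := dg (h y); have [d dl dE] := dh y.
exists (c * d)%g => [|r]; first exact: leq_trans (word_lengthM _ _ S_gen) (leq_add ck dl).
by rewrite symME cE dE invgM mulgA.
Qed.

Lemma displacesV g k : displaces g k -> displaces g^-1%g k.
Proof.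
move=> dg y; have [c ck cE] := dg (g^-1%g y).
exists c^-1%g => [|r]; first exact: leq_trans (word_lengthV _ S_gen) ck.
by rewrite symKV in cE; rewrite cE invgK mulgA mulVg mul1g.
Qed.

Lemma ev_link k : exists2 c, word_length S c <= 1 &
  forall w r, ev (gact (nth (Nop H) lk k) w) r <-> ev w (c^-1 * r)%g.
Proof.
have triv a : (forall w r, ev (gact a w) r <-> ev w r) -> exists2 c, word_length S c <= 1 &
    forall w r, ev (gact a w) r <-> ev w (c^-1 * r)%g.
  move=> aE; exists 1%g => [|w r]; first by rewrite word_length1.
  by rewrite invg1 mul1g.
case: k => [|[|[|[|k]]]]; try by apply: triv => w r; exact: ev_push.
have -> : nth (Nop H) lk k.+4 = nth (Nop H) [seq Act h | h <- S] k by [].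
have [kS|kS] := ltnP k (size S); last by rewrite nth_default ?size_map //; exact: triv.
rewrite (nth_map 1%g) //; exists (nth 1%g S k) => //.
by apply: word_length_le; apply: has_word_gen; exact: mem_nth.
Qed.

(** One step undoes the label of a brick and applies that of the next, and each translates by length
    at most 1. *)
Lemma displaces_alpha : displaces al 2.
Proof.
have ev_gnA e j : exists2 c, word_length S c <= 1 &
    forall w r, ev (gact (gnA N lk e j) w) r <-> ev w (c^-1 * r)%g.
  rewrite /gnA; case: ifP => _; first exact: ev_link.
  by exists 1%g => [|w r]; rewrite ?word_length1 //= invg1 mul1g.
move=> y; have [/in_rotP[e [j [w [le jm ->]]]]|ny] :=
    pselect (in_rot (ltA n N lk) (fun e j => gact (gnA N lk e j)) (N + 3 * t) m y); last first.
  exists 1%g => [|r]; first by rewrite word_length1.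
  by rewrite invg1 mul1g [al _]rot_fun_fix.
have [c c1 cE] := ev_gnA e j; have [d d1 dE] := ev_gnA e (j.+1 %% m).
exists (d * c^-1)%g.
  apply: leq_trans (word_lengthM _ _ S_gen) (leq_add d1 _).
  exact: leq_trans (word_lengthV _ S_gen) c1.
move=> r; have gI e' j' : injective (gact (gnA N lk e' j')) by exact: gact_inj.
rewrite [al _](rot_fun_block gI (ltA_inj m_ge2 n_ge3 N_large)) //.
by rewrite /rot_block /= dE cE invgM invgK mulgA mulKg.
Qed.

Lemma displaces_beta : displaces be 0.
Proof.
move=> y; exists 1%g => [|r]; first by rewrite word_length1.
rewrite invg1 mul1g; have [/in_rotP[e [j [w [le jm ->]]]]|ny] :=
    pselect (in_rot ltB (fun e j => gact (gnB H e j)) N n y); last by rewrite [be _]rot_fun_fix.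
have gI e' j' : injective (gact (gnB H e' j')) by exact: gact_inj.
by rewrite [be _](rot_fun_block gI (@ltB_inj n N)).
Qed.

Lemma displaces_exists g : P g -> exists k, displaces g k.
Proof.
move=> Pg; elim/big_group_ind: Pg => [|x y [k dk] [l dl]|x [k dk]||].
- by exists 0; exact: displaces1.
- by exists (k + l); exact: displacesM.
- by exists k; exact: displacesV.
- by exists 2; exact: displaces_alpha.
- by exists 0; exact: displaces_beta.
Qed.

Lemma displaces_embed h k : displaces (embed h) k -> word_length S h <= k.
Proof.
(* The stream at [None] puts the point in the half where H acts; among the indices in H only 1 has
   an eventually true stream, and it is taken to h. *)
pose w : W := fun s _ => (s == None) || (s == Some 1%g).
have evw r : ev w r <-> r = 1%g.
  split=> [[i /(_ i (leqnn _))]|->]; first by move=> /eqP[].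
  by exists 0 => i _; rewrite /w eqxx orbT.
move=> /(_ (V 0 0, w))[c ck cE]; suff -> : h = c by [].
have := cE h; rewrite [embed h _]embed_fun_in //= ev_act mulVg !evw => -[/(_ erefl) ch _].
by rewrite -(mulg1_eq ch) invgK.
Qed.


(** * The group generated by alpha and beta as a group in its own right *)

Local Notation G := (subgroup_of [set` [:: al; be]]%classic).

Definition G_embed h : G := Sub (embed h) (mem_set (big_group_embed h)).

Fact G_embedM : {morph G_embed : h k / (h * k)%g}.
Proof. by move=> h k; apply: val_inj; rewrite valM /= embedM. Qed.

HB.instance Definition _ := isMultiplicative.Build H G G_embed G_embedM.

Definition G_al : G := Sub al (mem_set (@big_group_al _ _ _ _ lk m_ge2 n_ge3 N_large)).
Definition G_be : G := Sub be (mem_set (@big_group_be _ _ _ _ lk m_ge2 n_ge3 N_large)).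

Lemma G_ind (C : G -> Prop) : C 1%g -> (forall x y, C x -> C y -> C (x * y)%g) ->
  (forall x, C x -> C x^-1%g) -> C G_al -> C G_be -> forall g, C g.
Proof.
move=> C1 CM CV Ca Cb; apply: subgroup_ind => // x /=; rewrite !inE.
have vE (y z : G) : val y = val z -> C y -> C z by move/val_inj ->.
by case/orP => /eqP xE; [apply: vE Ca|apply: vE Cb].
Qed.

Lemma G_generated : mn_generated G m n.
Proof.
exists G_al, G_be; split.
- by apply: subgroup_has_order; exact: alpha_order.
- by apply: subgroup_has_order; exact: beta_order.
apply/seteqP; split=> // g _ K [[K1 KD] KS].
have KV (x : G) : K x -> K x^-1%g.
  by move=> Kx; have := KD 1%g x; rewrite !in_setE div1g; apply; rewrite // -in_setE.
elim/G_ind: g => [|x y Kx Ky|||].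
- by rewrite -in_setE.
- by have := KD x y^-1%g; rewrite !in_setE invgK; apply => //; exact: KV.
- exact: KV.
- by apply: KS => /=; rewrite inE eqxx.
- by apply: KS => /=; rewrite !inE eqxx orbT.
Qed.

Lemma G_simple : simple_group G.
Proof.
split=> [GE|B [[B1 BD] BJ]].
  have [_ _ /(_ 1)] := alpha_order m_ge2 n_ge3 N_large; apply; first lia.
  have : [set: G]%classic G_al by [].
  by rewrite GE /= => /(congr1 val); rewrite val1.
have BV (x : G) : B x -> B x^-1%g.
  by move=> Bx; have := BD 1%g x; rewrite !in_setE div1g; apply; rewrite // -in_setE.
have BM (x y : G) : B x -> B y -> B (x * y)%g.
  by move=> Bx By; have := BD x y^-1%g; rewrite !in_setE invgK; apply => //; exact: BV.
rewrite in_setE in B1.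
have [[g Bg g1]|B_trivial] := pselect (exists2 g, B g & g <> 1%g); last first.
  left; apply/seteqP; split=> [g Bg|g -> //] /=.
  by apply: contrapT => g1; apply: B_trivial; exists g.
right; apply/seteqP; split=> // h _.
pose M := [set x | exists2 g : G, B g & val g = x]%classic.
have [|||||||[a Ba aE] [b Bb bE]] := @normal_all M _ _ _ _ _ (val g).
- by move=> x [y _ <-]; have := valP y; rewrite in_setE.
- by exists 1%g; rewrite ?val1.
- by move=> x y [x' Bx <-] [y' By <-]; exists (x' * y')%g; [exact: BM|rewrite valM].
- by move=> x [x' Bx <-]; exists x'^-1%g; [exact: BV|].
- move=> p x Pp [x' Bx <-]; pose q : G := Sub p (mem_set Pp).
  by exists (x' ^ q^-1)%g; [exact: BJ|rewrite conjgE invgK !valM mulgA].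
- by exists g.
- by move=> g1'; apply: g1; apply: val_inj; rewrite val1.
elim/G_ind: h => //.
- by have -> : G_al = a by exact: val_inj.
- by have -> : G_be = b by exact: val_inj.
Qed.

Lemma G_qi_embeds (R : realType) : qi_embeds R H G.
Proof.
exists G_embed; split.
  move=> h k /(congr1 val) /= hk; apply/eqP; rewrite -divg_eq1; apply/eqP.
  (* An element of the kernel displaces nothing, hence has word length 0. *)
  have : displaces (embed (h / k)%g) 0.
    rewrite embedM hk -embedM mulgV.
    have -> : embed 1%g = 1%g; last exact: displaces1.
    by apply: (mulgI (embed 1%g)); rewrite -embedM !mulg1.
  move/displaces_embed; rewrite leqn0 => /eqP h0.
  have := word_lengthP (h / k)%g S_gen; rewrite h0 => -[w [_ /size0nil -> <-]].
  by rewrite big_nil.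
move=> S' T S'_gen T_gen.
have [c cP] : exists c, forall x, word_length S' x <= c * word_length S x.
  apply: (word_length_bound (K := fun x k => word_length S' x <= k) S_gen).
  - by rewrite word_length1.
  - by move=> x y k l xk yl; exact: leq_trans (word_lengthM _ _ S'_gen) (leq_add xk yl).
  - by move=> x k; apply: leq_trans; exact: word_lengthV.
  - by move=> x k l; exact: leq_trans.
  - by move=> x; exists (word_length S' x).
(* The factor c passes from the fixed generators [S] to the arbitrary ones [S']. *)
pose D (g : G) k := exists2 l, displaces (val g) l & c * l <= k.
apply: (@qi_embedding_of_bounds _ _ _ G_embed S' T D) => //.
- by exists 0; rewrite ?muln0 // val1; exact: displaces1.
- move=> g h k l [k' dk kk] [l' dl ll]; exists (k' + l'); last by rewrite mulnDr leq_add.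
  by rewrite valM; exact: displacesM.
- by move=> g k [l dl lk]; exists l => //; exact: displacesV.
- by move=> g k l [k' dk kk] kl; exists k' => //; exact: leq_trans kl.
- move=> g; have [k dk] : exists k, displaces (val g) k.
    by apply: displaces_exists; rewrite /big_group -in_setE; exact: valP.
  by exists (c * k), k.
- move=> x k [l /displaces_embed xl lk].
  by apply: leq_trans (cP x) (leq_trans _ lk); rewrite leq_mul2l xl orbT.
Qed.

End Embedding.

Theorem corollary10 (R : realType) (m n : nat) (hm : 2 <= m) (hn : 3 <= n)
    (H : groupType) (hH : finitely_generated H) :
  exists G : groupType,
    [/\ simple_group G, mn_generated G m n & qi_embeds R H G].
Proof.
case: hH => S S_gen; pose t := size (links S).
(* The prime p = N + 1 will be the length of the prime face; the bound dominates all the lower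
   bounds imposed on N. *)
have [p p_large p_prime] := prime_above (6 * t + (1 + 4 * t) * (m + n) + 4 * (m + n) + m + 12).
have [N NE] : exists N, p = N.+1 by exists p.-1; lia.
rewrite {}NE in p_large p_prime.
have N_large : 6 * size (links S) + 10 <= N by rewrite -/t; lia.
have tK : (1 + 4 * t) * (m + n - 3) <= (1 + 4 * t) * (m + n) by rewrite leq_mul2l leq_subr orbT.
have N_large1 : (1 + 4 * size (links S)) * (m + n - 3) + 1 < N by rewrite -/t; lia.
have N_large2 : 4 * (m + n - 3) + m < N by lia.
exists (subgroup_of [set` [:: alpha hm hn N_large; beta hm hn N_large]]%classic); split.
- exact: G_simple.
- exact: G_generated.
- exact: G_qi_embeds.
Qed.
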